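(* Let $M$ be a compact (connected) Riemannian manifold of dimension $n$, equipped with its geodesic distance, let $r>0$, and let $p=\mathrm{pack}_M(r)$ be the packing number of $M$ at scale $r$. Then the Čech cohomology $\check{H}^k(\mathrm{AVR}^m(M;r))$ (with integer coefficients) vanishes for all $k\ge (n+1)p$.
   Context: For a metric space $(X,d)$, a subset $S\subseteq X$ is an $r$-packing if $d(x,x')\ge r$ for all $x,x'\in S$ with $x\ne x'$; the packing number $\mathrm{pack}_X(r)$ is the largest cardinality of an $r$-packing of $X$. For $r\ge 0$, the anti-Vietoris--Rips metric thickening $\mathrm{AVR}^m(X;r)$ is the set of all finitely supported probability measures $\sum_{i=0}^k\lambda_i\delta_{x_i}$ on $X$ (with $k\ge 0$, $\lambda_i>0$, $\sum_i\lambda_i=1$, the $x_i$ distinct) such that $d(x_i,x_j)\ge r$ for all $i\ne j$. It is equipped with the (topology of the) $1$-Wasserstein metric $W_1(\mu,\nu)=\inf_{\pi}\int_{X\times X}d(x,y)\,d\pi$, where the infimum is over probability measures $\pi$ on $X\times X$ with marginals $\mu$ and $\nu$. *)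

(* Defs.v *)
From HB Require Import structures.
From Stdlib Require Import Relation_Operators.
From mathcomp Require Import all_boot all_order all_algebra generic_quotient.
From mathcomp Require Import all_classical all_reals all_analysis.

Set Implicit Arguments.
Unset Strict Implicit.
Unset Printing Implicit Defensive.

Import Order.TTheory GRing.Theory Num.Theory.
Import numFieldNormedType.Exports.

Local Open Scope quotient_scope.
Local Open Scope card_scope.
Local Open Scope classical_set_scope.
Local Open Scope ring_scope.

(* measurable spaces are pointed in the library, hence the nonempty metric
   spaces below *)
#[short(type="pmetricType")]
HB.structure Definition PointedMetric (K : numDomainType) :=
  { M of Metric K M & Pointed M }.

(* For D open: f is continuous on D and so are all its iterated directional
   derivatives of order at most k. *)
Fixpoint class_C {R : realType} {V W : normedModType R} (k : nat) (D : set V)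
    (f : V -> W) : Prop :=
  if k is k'.+1 then
    (forall x, D x -> differentiable f x) /\
    (forall v, class_C k' D (fun x => 'D_v f x))
  else forall x, D x -> {for x, continuous f}.

Definition smooth_on {R : realType} {V W : normedModType R} (D : set V)
    (f : V -> W) : Prop := forall k, class_C k D f.

(* [coord i] is a homeomorphism from the open set [dom i] onto an open subset
   of R^n, with inverse [param i]; both are total functions whose values
   outside these sets are irrelevant. There is no boundary. *)
Record smooth_atlas (R : realType) (n : nat) (M : topologicalType) := SmoothAtlas {
  chart : Type ;
  dom : chart -> set M ;
  coord : chart -> M -> 'rV[R]_n ;
  param : chart -> 'rV[R]_n -> M ;
  chart_at : M -> chart ;
  dom_chart_at : forall x, dom (chart_at x) x ;
  dom_open : forall i, open (dom i) ;
  coord_open : forall i, open (coord i @` dom i) ;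
  coordK : forall i x, dom i x -> param i (coord i x) = x ;
  coord_continuous : forall i x, dom i x -> {for x, continuous (coord i)} ;
  param_continuous : forall i y, (coord i @` dom i) y ->
    {for y, continuous (param i)} ;
  transition_smooth : forall i j,
    smooth_on (coord i @` (dom i `&` dom j)) (coord j \o param i)
}.

(* [gram i x] is the matrix of the inner product on the tangent space at x in
   the basis of coordinate vector fields of the chart i. Vectors are rows:
   the differential of f acts by v |-> v *m jacobian f. *)
Record riemannian_metric (R : realType) (n : nat) (M : topologicalType)
    (A : smooth_atlas R n M) := RiemannianMetric {
  gram : chart A -> M -> 'M[R]_n ;
  gram_sym : forall i x, dom i x -> (gram i x)^T = gram i x ;
  gram_posdef : forall i x, dom i x -> forall v : 'rV[R]_n, v != 0 ->
    0 < (v *m gram i x *m v^T) 0 0 ;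
  gram_smooth : forall i, smooth_on (coord i @` dom i) (gram i \o param i) ;
  gram_transition : forall i j x, dom i x -> dom j x ->
    let J := jacobian (coord j \o param i) (coord i x) in
    gram i x = J *m gram j x *m J^T
}.

Section geodesic_distance.
Context {R : realType} {n : nat} {M : topologicalType}.
Variables (A : smooth_atlas R n M) (g : riemannian_metric A).

Definition C1_curve_on (O : set R) (c : R -> M) : Prop :=
  forall t, O t -> {for t, continuous c} /\
    forall i : chart A, dom i (c t) ->
      (\forall u \near t, derivable (coord i \o c) u 1) /\
      {for t, continuous (derive1 (coord i \o c))}.

(* On each closed piece, [c] extends to a C^1 curve on an open interval. *)
Definition piecewise_C1 (c : R -> M) : Prop :=
  {within `[0, 1], continuous c} /\
  exists (m : nat) (t : nat -> R),
    [/\ t 0%N = 0, t m = 1 &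
      forall j, (j < m)%N -> t j < t j.+1 /\
        exists (a b : R) (e : R -> M),
          [/\ a < t j, t j.+1 < b, C1_curve_on `]a, b[ e &
            forall u, t j <= u <= t j.+1 -> c u = e u]].

(* The Riemannian norm of c'(t); by [gram_transition] it does not depend on
   the chart around c(t). *)
Definition speed (c : R -> M) (t : R) : R :=
  let i := chart_at A (c t) in
  let v := derive1 (coord i \o c) t in
  Num.sqrt ((v *m gram g i (c t) *m v^T) 0 0).

Definition curve_length (c : R -> M) : \bar R :=
  (\int[lebesgue_measure]_(t in `[0%R, 1%R]) (speed c t)%:E)%E.

Definition geodesic_dist (x y : M) : \bar R :=
  ereal_inf [set curve_length c | c in
    [set c | [/\ piecewise_C1 c, c 0 = x & c 1 = y]]].

End geodesic_distance.

Definition packing {R : realType} {X : metricType R} (r : R) (S : set X) : Prop :=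
  forall x x', S x -> S x' -> x <> x' -> r <= mdist x x'.

Definition is_packing_number {R : realType} (X : metricType R) (r : R)
    (p : nat) : Prop :=
  (exists2 S : set X, packing r S & S #= `I_p) /\
  (forall S : set X, packing r S -> S #<= `I_p).

Definition borel {R : realType} (X : pmetricType R) :=
  g_sigma_algebraType (@open X).

Section anti_vietoris_rips.
Context {R : realType}.

Definition coupling (X : pmetricType R) (mu nu : probability (borel X) R)
    (pi : probability (borel X * borel X)%type R) : Prop :=
  forall B : set (borel X), measurable B ->
    pi (B `*` setT) = mu B /\ pi (setT `*` B) = nu B.

Definition W1 (X : pmetricType R) (mu nu : probability (borel X) R) : \bar R :=
  ereal_inf [set (\int[pi]_z (mdist (z.1 : X) (z.2 : X))%:E)%E
    | pi in coupling mu nu].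

(* A library measure is a function on all subsets, so the equation is imposed
   on all of them: a point is then determined by the values of its measure on
   measurable sets. *)
Definition avr_supported (X : pmetricType R) (r : R)
    (mu : probability (borel X) R) : Prop :=
  exists (k : nat) (x : 'I_k.+1 -> X) (w : 'I_k.+1 -> R),
    [/\ forall i, 0 < w i,
        \sum_i w i = 1,
        forall i j, i != j -> x i <> x j /\ r <= mdist (x i) (x j) &
        forall B : set (borel X),
          mu B = (\sum_i (w i)%:E * \d_(x i : borel X) B)%E].

Record AVRm (X : pmetricType R) (r : R) := AVRMeasure {
  avr_measure : probability (borel X) R ;
  avr_measureP : avr_supported r avr_measure
}.

Variables (X : pmetricType R) (r : R).

HB.instance Definition _ := gen_eqMixin (AVRm X r).
HB.instance Definition _ := gen_choiceMixin (AVRm X r).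

Definition avr_open (U : set (AVRm X r)) : Prop :=
  forall mu, U mu -> exists2 e : R, 0 < e &
    forall nu, (W1 (avr_measure mu) (avr_measure nu) < e%:E)%E -> U nu.

Lemma avr_openT : avr_open setT.
Proof. by move=> mu _; exists 1. Qed.

Lemma avr_openI : setI_closed avr_open.
Proof.
move=> U V oU oV mu [/oU[d d0 dU] /oV[e e0 eV]].
exists (Num.min d e); first by rewrite lt_min d0.
move=> nu h; split; [apply: dU | apply: eV]; apply: (lt_le_trans h);
  by rewrite lee_fin ge_min lexx ?orbT.
Qed.

Lemma avr_open_bigU (I : Type) (f : I -> set (AVRm X r)) :
  (forall i, avr_open (f i)) -> avr_open (\bigcup_i f i).
Proof.
move=> fo mu [i _ /fo[e e0 he]]; exists e => // nu /he ?; by exists i.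
Qed.

HB.instance Definition _ :=
  isOpenTopological.Build (AVRm X r) avr_openT avr_openI avr_open_bigU.

End anti_vietoris_rips.

Definition open_cover {X : topologicalType} (U : set (set X)) : Prop :=
  (forall u, U u -> open u) /\ \bigcup_(u in U) u = setT.

(* An ordered k-simplex, possibly degenerate, of the nerve of U. The cochain
   complex below is the ordered (not the alternating) one; both have the same
   cohomology. *)
Record nerve_simplex (X : Type) (U : set (set X)) (k : nat) := NerveSimplex {
  vertex :> 'I_k.+1 -> set X ;
  vertex_in : forall i, U (vertex i) ;
  vertex_meet : \bigcap_i vertex i !=set0
}.

Definition cochain (X : Type) (U : set (set X)) (k : nat) : Type :=
  nerve_simplex U k -> int.

Section nerve.
Context {X : Type}.
Implicit Types U V : set (set X).

Lemma face_meet U k (i : 'I_k.+2) (s : nerve_simplex U k.+1) :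
  \bigcap_j s (lift i j) !=set0.
Proof. by have [x hx] := vertex_meet s; exists x => j _; exact: hx. Qed.

Definition face U k (i : 'I_k.+2) (s : nerve_simplex U k.+1) :
    nerve_simplex U k :=
  NerveSimplex (fun j => vertex_in s (lift i j)) (face_meet i s).

Definition coboundary U k (c : cochain U k) : cochain U k.+1 :=
  fun s => \sum_(i < k.+2) (-1) ^+ i * c (face i s).

Definition is_coboundary U k : cochain U k -> Prop :=
  if k is k'.+1 then fun c => exists b : cochain U k', coboundary b = c
  else fun c => c = 0.

Definition refinement_map U V (p : set X -> set X) : Prop :=
  forall v, V v -> U (p v) /\ v `<=` p v.

Section pullback.
Variables (U V : set (set X)) (p : set X -> set X) (hp : refinement_map U V p).

Lemma refine_in k (s : nerve_simplex V k) i : U (p (s i)).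
Proof. by case: (hp (vertex_in s i)). Qed.

Lemma refine_meet k (s : nerve_simplex V k) : \bigcap_i p (s i) !=set0.
Proof.
have [x hx] := vertex_meet s; exists x => i _.
by case: (hp (vertex_in s i)) => _; apply; exact: hx.
Qed.

Definition refine_simplex k (s : nerve_simplex V k) : nerve_simplex U k :=
  NerveSimplex (refine_in s) (refine_meet s).

Definition pullback k (c : cochain U k) : cochain V k :=
  fun s => c (refine_simplex s).

End pullback.
End nerve.

Section cech.
Variables (X : topologicalType) (k : nat).

Record cech_cocycle := CechCocycle {
  cech_cover : set (set X) ;
  cech_coverP : open_cover cech_cover ;
  cech_cochain : cochain cech_cover k ;
  cech_cochainP : coboundary cech_cochain = 0
}.

Arguments cech_cochain : clear implicits.

HB.instance Definition _ := gen_eqMixin cech_cocycle.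
HB.instance Definition _ := gen_choiceMixin cech_cocycle.

(* z' is cohomologous to the restriction of z along some refinement; the case
   of equal covers gives the cohomology relation on a single nerve. *)
Definition cech_step (z z' : cech_cocycle) : Prop :=
  exists (p : set X -> set X)
    (hp : refinement_map (cech_cover z) (cech_cover z') p),
    is_coboundary (cech_cochain z' - pullback hp (cech_cochain z)).

Definition cech_rel (z z' : cech_cocycle) : bool :=
  `[< clos_refl_sym_trans _ cech_step z z' >].

Lemma cech_rel_refl : reflexive cech_rel.
Proof. by move=> z; apply/asboolP; exact: rst_refl. Qed.

Lemma cech_rel_sym : symmetric cech_rel.
Proof.
by move=> z z'; apply/asboolP/asboolP => h; exact: rst_sym.
Qed.

Lemma cech_rel_trans : transitive cech_rel.
Proof.
move=> z2 z1 z3 /asboolP h12 /asboolP h23; apply/asboolP.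
exact: rst_trans h12 h23.
Qed.

Canonical cech_equiv := EquivRel cech_rel cech_rel_refl cech_rel_sym cech_rel_trans.

(* The direct limit over all open covers, ordered by refinement, of the
   cohomology of the nerves: as a set, a directed colimit of groups is the
   quotient of the disjoint union by the relation generated by the transition
   maps. *)
Definition cech_cohomology : Type := {eq_quot cech_equiv}.

Lemma open_cover_setT : open_cover [set (setT : set X)].
Proof. by split; [move=> _ ->; exact: openT | rewrite bigcup_set1]. Qed.

Lemma coboundary0 :
  coboundary (0 : cochain [set (setT : set X)] k) = 0.
Proof. by apply/funext => s; rewrite /coboundary big1 // => i _; rewrite mulr0. Qed.

Definition cech_zero : cech_cohomology :=
  \pi_({eq_quot cech_equiv}) (CechCocycle open_cover_setT coboundary0).

Definition cech_cohomology_vanishes : Prop :=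
  forall h : cech_cohomology, h = cech_zero.

End cech.

Arguments cech_cochain {X k} _ _.

(* Main.v *)
(* A measure in AVR is described by p points of M and p weights of sum 1, so the
   parameter space has dimension np + (p - 1) = (n+1)p - 1, and the parameters
   depend on the measure only through its atoms. Charts are locally Lipschitz for
   the geodesic distance, and the dual distance (the supremum of
   |int f dmu - int f dnu| over 1-Lipschitz f with values in [0, 1]) is Lipschitz
   in the parameters. Hence, with N = (n+1)p, AVR can be cut into O(m^(N-1)) pieces
   of dual diameter O(1/m). AVR is compact for W1 and the dual distance is a
   continuous metric on it, so small dual balls refine any open cover. By counting
   pieces, the radii of finitely many balls can be chosen so that no point is close
   to N of the boundary spheres; the successive differences of the balls then give
   a refinement with at most N members through each point. Every ordered simplex of
   dimension k >= N of its nerve has a repeated vertex, and the comparison of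
   ordered simplices with strictly increasing ones shows that every k-cocycle of
   this nerve is a coboundary. *)
From Stdlib Require Import Relation_Operators.
Require Import Defs.
From mathcomp Require Import all_boot all_order all_algebra generic_quotient.
From mathcomp Require Import boolp zify ring lra.

Set Implicit Arguments.
Unset Strict Implicit.
Unset Printing Implicit Defensive.

Import Order.TTheory GRing.Theory Num.Theory.

Local Open Scope ring_scope.

(** * General position by counting *)

Section slots.
Local Open Scope nat_scope.

(** Used for the shells met by a piece of small diameter: with [i] the least element of [B], every
    element is [i] or [i.+1]. *)
Lemma card_close_ord m (B : {set 'I_m}) :
  (forall i j, i \in B -> j \in B -> j <= i.+1) -> #|B| <= 2.
Proof.
move=> hB; have [->|[i0 i0B]] := set_0Vmem B; first by rewrite cards0.
case: (arg_minnP val i0B) => i iB imin.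
rewrite cardE -(size_map val); apply: (@uniq_leq_size _ _ [:: val i; i.+1]).
  by rewrite map_inj_uniq ?enum_uniq//; exact: val_inj.
move=> _ /mapP[j + ->]; rewrite mem_enum => jB.
have := imin _ jB; have := hB _ _ iB jB; rewrite !inE /=; lia.
Qed.

(* First-moment count over uniformly random positions [k]. *)
Lemma exists_general_position q m N (T : finType) (hit : T -> 'I_q -> 'I_m -> bool) :
  0 < N -> (forall t a, #|[set i | hit t a i]| <= 2) -> #|T| * 4 ^ q < m ^ N ->
  exists k : {ffun 'I_q -> 'I_m}, forall t, #|[set a | hit t a (k a)]| < N.
Proof.
move=> N0 hit2 Tm; apply: contrapT => /forallNP bad.
have m0 : 0 < m by case: m Tm {hit hit2 bad} => //; rewrite exp0n.
(* [family (F t A)] holds the positions that [t] hits at every index of [A]; a bad position lies in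
   one of these with [N <= #|A|]. *)
pose F (t : T) (A : {set 'I_q}) a := if a \in A then [set i | hit t a i] else [set: 'I_m].
have FN t (A : {set 'I_q}) : N <= #|A| -> #|family (F t A)| <= 2 ^ q * m ^ (q - N).
  move=> AN; rewrite card_family /= foldrE big_map big_enum /=.
  rewrite (bigID (mem A)) /=; apply: leq_mul.
    apply: (@leq_trans (\prod_(i in A) 2)).
      by apply: leq_prod => a aA; rewrite /F aA.
    by rewrite prod_nat_const leq_exp2l// -[X in _ <= X]card_ord max_card.
  rewrite (eq_bigr (fun=> m)) => [|a /negPf aA]; last by rewrite /F aA cardsT card_ord.
  rewrite prod_nat_const leq_pexp2l//.
  have -> : #|[pred i | i \notin A]| = q - #|A|; last by rewrite leq_sub2l.
  by rewrite -[X in X - _]card_ord -(cardC A) addKn; apply: eq_card => i.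
have Nq : N <= q.
  have /existsNP[t /negP] := bad [ffun=> Ordinal m0]; rewrite -leqNgt.
  by move=> /leq_trans; apply; rewrite -[X in _ <= X]card_ord max_card.
have cov : [set: {ffun 'I_q -> 'I_m}] \subset
    \bigcup_(tA : T * {set 'I_q} | N <= #|tA.2|) [set k | k \in family (F tA.1 tA.2)].
  apply/fintype.subsetP => k _; have /existsNP[t /negP] := bad k; rewrite -leqNgt => Nt.
  apply/bigcupP; exists (t, [set a | hit t a (k a)]) => //.
  by rewrite inE; apply/familyP => a; rewrite /F; case: ifP; rewrite !inE.
have := subset_leq_card cov; rewrite cardsT card_ffun !card_ord leqNgt => /negP; apply.
(* Union bound: there are at most [#|T| * 2 ^ q] pairs [(t, A)], whence the factor [4 ^ q] in the
   hypothesis. *)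
apply: (@leq_ltn_trans (\sum_(tA : T * {set 'I_q} | N <= #|tA.2|) 2 ^ q * m ^ (q - N))).
  elim/big_rec2: _ => [|tA B s NA]; first by rewrite cards0.
  move=> sB; apply: leq_trans (leq_card_setU _ _).1 _; apply: leq_add => //.
  by rewrite cardsE; exact: FN.
apply: (@leq_ltn_trans (#|{: T * {set 'I_q}}| * (2 ^ q * m ^ (q - N)))).
  by rewrite sum_nat_cond_const leq_mul2r max_card orbT.
rewrite card_prod -[#|{set _}|]cardsT -powersetT card_powerset cardsT card_ord.
by rewrite -[X in _ < m ^ X](subnKC Nq) expnD mulnA ltn_pmul2r ?expn_gt0 ?m0// -mulnA -expnMn.
Qed.
End slots.

(** * Ordered cochains *)

Section ordered_cochains.
Implicit Types (f g : seq nat -> int) (s t : seq nat).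

(* The augmented ordered coboundary, by expansion along the first vertex:
   [cobd f [:: s_0; ..; s_k]] is the alternating sum of the values of [f] on
   the faces. *)
Fixpoint cobd f s : int :=
  if s is x :: s' then f s' - cobd (fun t => f (x :: t)) s' else 0.

Lemma eq_cobd f g s :
  (forall t, (size t).+1 = size s -> {subset t <= s} -> f t = g t) ->
  cobd f s = cobd g s.
Proof.
elim: s f g => //= x s IH f g fg; congr (_ - _).
  by apply: fg => // y ys; rewrite inE ys orbT.
apply: IH => t ts sub; apply: fg; first by rewrite /= ts.
move=> y; rewrite !inE => /orP[->//|/sub->]; by rewrite orbT.
Qed.

Lemma cobdB f g s : cobd (fun t => f t - g t) s = cobd f s - cobd g s.
Proof.
elim: s f g => [|x s IH] f g /=; first by rewrite subr0.
by rewrite (IH (fun t => f (x :: t))) !opprB addrACA [RHS]addrACA; congr (_ + _); rewrite addrC.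
Qed.

Lemma cobd_cobd f s : cobd (cobd f) s = 0.
Proof.
elim: s f => [|x s IH] f //=.
by rewrite (cobdB f (cobd (fun t => f (x :: t)))) IH subr0 subrr.
Qed.

Definition minseq s : nat := foldr minn (head 0%N s) s.

Lemma minseq_in s : s != [::] -> minseq s \in s.
Proof.
case: s => // x s _; rewrite /minseq /=.
suff : foldr minn x s \in x :: s.
  by rewrite /minn; case: ifP; rewrite ?mem_head.
elim: s => [|y s IH] /=; first by rewrite inE.
rewrite /minn; case: ifP => _; first by rewrite !inE eqxx orbT.
by move: IH; rewrite !inE => /orP[->//|->]; rewrite !orbT.
Qed.

Lemma minseq_le s x : x \in s -> (minseq s <= x)%N.
Proof.
rewrite /minseq; move: (head _ _) => z; elim: s => //= y s IH.
rewrite inE => /orP[/eqP->|/IH]; first exact: geq_minl.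
by apply: leq_trans; exact: geq_minr.
Qed.

(* The cone with apex [w], made zero on simplices starting at [w] so that coning
   keeps simplices strictly increasing. *)
Definition ncone w f t : int := if (t != [::]) && (head 0%N t == w) then 0 else f (w :: t).

(* Value on [s] of the dual of a chain map from ordered simplices to strictly
   increasing ones, built by coning off along least vertices. *)
Fixpoint incr n f s : int :=
  if n is n'.+1 then cobd (incr n' (ncone (minseq s) f)) s else f s.

(** Coning prepends the least vertex and gives zero when that would repeat the head, so only
    strictly increasing sequences contribute. *)
Lemma eq_incr n f g s : size s = n ->
  (forall t, sorted ltn t -> size t = n -> {subset t <= s} -> f t = g t) ->
  incr n f s = incr n g s.
Proof.
elim: n f g s => [|n IH] f g s sn fg /=.
  by apply: fg => //; move/size0nil: sn => ->.
apply: eq_cobd => t; rewrite sn => -[tn] ts; apply: IH => // u us un ut.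
have s0 : s != [::] by rewrite -size_eq0 sn.
rewrite /ncone; case: ifPn => // h; apply: fg => /=.
- case: u us un ut h => //= y u us un ut h; rewrite us andbT ltn_neqAle.
  by rewrite eq_sym h minseq_le// ts// ut// mem_head.
- by rewrite un.
- by move=> y; rewrite inE => /orP[/eqP->|/ut/ts//]; exact: minseq_in.
Qed.

Lemma incrB n f g s : incr n (fun t => f t - g t) s = incr n f s - incr n g s.
Proof.
elim: n f g s => //= n IH f g s; rewrite -cobdB; apply: eq_cobd => t _ _.
rewrite -IH; congr (incr n _ t); apply/funext => u.
by rewrite /ncone; case: ifP => _ //; rewrite subrr.
Qed.

(** A strictly increasing sequence of length [n] inside [s] would make the entries of [s] distinct,
    so [f] may be replaced by zero, written [f t - f t]. *)
Lemma incr_eq0 n f s : size s = n -> ~~ uniq s -> incr n f s = 0.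
Proof.
move=> sn su; rewrite (@eq_incr n f (fun t => f t - f t)) ?incrB ?subrr// => t.
move=> /(sorted_uniq ltn_trans ltnn) ut tn ts.
by move: su; rewrite (leq_size_uniq ut ts)// tn sn.
Qed.

(** The faces of [w :: t] are [t] and the cones over the faces of [t]. If [t] already starts at [w],
    the term [f t] returns as the cone over the face omitting [w]. *)
Lemma ncone_cobd w f t : sorted ltn t -> all (leq w) t ->
  ncone w (cobd f) t = f t - cobd (ncone w f) t.
Proof.
case: t => [|x t] xt; first by [].
case/andP; rewrite leq_eqVlt => /predU1P[wx|wx] wt.
  have -> : cobd (ncone w f) (x :: t) = f (x :: t).
    have c0 : cobd (fun u => ncone w f (x :: u)) t = 0.
      rewrite -(@eq_cobd (fun u => f u - f u)) ?cobdB ?subrr// => u _ _.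
      by rewrite subrr /ncone /= wx eqxx.
    rewrite /= c0 subr0 /ncone wx; case: t xt {wt c0} => [|y t] //= /andP[xy _].
    by rewrite gtn_eqF.
  by rewrite /ncone /= wx eqxx subrr.
rewrite {1}/ncone /= gtn_eqF//= -/(cobd (ncone w f) (x :: t)).
congr (_ - _); apply: (@eq_cobd (fun u => f (w :: u)) _ (x :: t)) => u _ ut.
rewrite /ncone; case: u ut => //= y u /(_ y (mem_head _ _)) yt.
suff wy : (w < y)%N by rewrite gtn_eqF.
move: yt; rewrite inE => /predU1P[->//|yt].
by apply: (ltn_trans wx); move: xt; rewrite /= path_sortedE; [case/andP => /allP/(_ _ yt)|exact: ltn_trans].
Qed.

(** The cone identity turns the coned coboundary into [f] minus a coboundary; by induction the
    latter stays a coboundary and dies by [cobd_cobd]. *)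
Lemma incr_cobd n f s : size s = n ->
  incr n (cobd f) s = cobd (incr n.-1 f) s.
Proof.
elim: n f s => [|n IH] f s sn /=; first by move/size0nil: sn => ->.
have s0 : s != [::] by rewrite -size_eq0 sn.
set w := minseq s.
transitivity (cobd (fun t => incr n f t - cobd (incr n.-1 (ncone w f)) t) s).
  apply: eq_cobd => t; rewrite sn => -[tn] ts; rewrite -IH// -incrB.
  apply: eq_incr => // u us un ut; apply: ncone_cobd => //.
  by apply/allP => y /ut/ts; exact: minseq_le.
by rewrite cobdB cobd_cobd subr0.
Qed.

(* A chain homotopy between the identity and [incr]: cone off from the first
   vertex what is left of the homotopy formula. *)
Fixpoint homot f s (n : nat) : int :=
  match n, s with
  | n'.+1, v :: _ => let fv := fun t => f (v :: t) in
      fv s - incr n fv s - cobd (fun t => homot fv t n') s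
  | _, _ => 0
  end.

Lemma eq_homot n f g s : size s = n ->
  (forall t, size t = n.+1 -> {subset t <= s} -> f t = g t) ->
  homot f s n = homot g s n.
Proof.
elim: n f g s => [|n IH] f g [|v s] //= sn fg; congr (_ - _ - _).
- by apply: fg; rewrite /= ?sn// => y; rewrite !inE orbA orbb.
- apply: (@eq_incr n.+1 (fun t => f (v :: t)) (fun t => g (v :: t)) (v :: s)) => // t _ tn ts; apply: fg; first by rewrite /= tn.
  by move=> y; rewrite inE => /predU1P[->|/ts//]; exact: mem_head.
- apply: (@eq_cobd (fun t => homot (fun t => f (v :: t)) t n) (fun t => homot (fun t => g (v :: t)) t n) (v :: s)) => t [tn] ts; apply: IH; first by rewrite tn; case: sn.
  move=> u un ut; apply: fg; first by rewrite /= un.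
  by move=> y; rewrite inE => /predU1P[->|/ut/ts//]; exact: mem_head.
Qed.

Lemma homotS n f v s : let fv := fun t => f (v :: t) in
  homot f (v :: s) n.+1 = fv (v :: s) - incr n.+1 fv (v :: s)
    - cobd (fun t => homot fv t n) (v :: s).
Proof. by []. Qed.

Lemma homotB n f g s :
  homot (fun t => f t - g t) s n = homot f s n - homot g s n.
Proof.
elim: n f g s => [|n IH] f g [|v s]; rewrite ?subrr//.
rewrite !homotS; set fv := fun t => f (v :: t); set gv := fun t => g (v :: t).
rewrite (incrB _ fv gv).
have -> : cobd (fun t => homot (fun t => fv t - gv t) t n) (v :: s) =
    cobd (fun t => homot fv t n) (v :: s) - cobd (fun t => homot gv t n) (v :: s).
  by rewrite -cobdB; apply: eq_cobd => t _ _; exact: IH.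
ring.
Qed.

Lemma homotP n f s : size s = n ->
  homot (cobd f) s n + cobd (fun t => homot f t n.-1) s = f s - incr n f s.
Proof.
elim: n f s => [|n IH] f [|v s] sn; rewrite ?subrr ?addr0//.
set fv := fun t => f (v :: t).
pose gv t := f t - cobd fv t.
have -> : homot (cobd f) (v :: s) n.+1 = gv (v :: s) - incr n.+1 gv (v :: s)
    - cobd (fun t => homot gv t n) (v :: s) by [].
rewrite incrB (@incr_cobd n.+1 fv)// [n.+1.-1]/=.
suff -> : cobd (fun t => homot gv t n) (v :: s) =
    cobd (fun t => homot f t n) (v :: s)
    - (cobd fv (v :: s) - cobd (incr n fv) (v :: s)).
  rewrite /gv; ring.
(* The zero introduced here is read as a double coboundary of the homotopy of [fv], so that the
   induction hypothesis applies to [fv] face by face. *)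
rewrite -cobdB -[in RHS](subr0 (cobd (fun t => fv t - incr n fv t) _)).
rewrite -(cobd_cobd (fun t => homot fv t n.-1) (v :: s)) -!cobdB.
apply: eq_cobd => t tn ts; rewrite homotB -IH ?addrK//.
by move: tn; rewrite sn => -[].
Qed.

End ordered_cochains.

(* [classical_sets] takes over the notation [[set x | P]] of [finset]; [Defs] is
   imported again because [vector] hides [coord]. *)
From mathcomp Require Import all_classical all_reals all_analysis measurable_realfun.
Require Import Defs.

Import numFieldNormedType.Exports.

Local Open Scope quotient_scope.
Local Open Scope card_scope.
Local Open Scope classical_set_scope.
Local Open Scope ring_scope.

(** * Cech cohomology and the order of covers *)

(** Omitting the first vertex is the first term of the recursion; keeping it shifts the other
    indices by one, which costs a sign. *)
Lemma cobd_codom n (f : seq nat -> int) (a : 'I_n -> nat) :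
  cobd f (codom a) = \sum_(i < n) (-1) ^+ i * f (codom (a \o lift i)).
Proof.
elim: n f a => [|n IH] f a; first by rewrite codomE enum_ord0 big_ord0.
have codomS m (b : 'I_m.+1 -> nat) :
    codom b = b ord0 :: codom (b \o lift ord0).
  by rewrite !codomE enum_ordSl /= -map_comp.
rewrite codomS big_ord_recl /= expr0 mul1r; congr (_ + _).
rewrite IH -sumrN; apply: eq_bigr => i _.
rewrite /bump /= add1n exprS mulN1r mulNr; congr (- (_ * f _)).
case: n i a IH => [[]//|n] i a IH.
rewrite [RHS]codomS /=; congr (a _ :: _); first exact/val_inj.
by apply/eq_codom => j /=; congr a; apply/val_inj; rewrite /= /bump !add1n ltnS addnS.
Qed.

Section nerve_simplices.
Variables (X : Type) (V : set (set X)) (idx : set X -> nat).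
Hypothesis idx_inj : forall v w, V v -> V w -> idx v = idx w -> v = w.

Definition indices k (s : nerve_simplex V k) : seq nat := codom (idx \o s).

Lemma nerve_simplex_eq k (s t : nerve_simplex V k) : s =1 t -> s = t.
Proof.
case: s t => [s s1 s2] [t t1 t2] /= /funext st; subst t.
by congr NerveSimplex; exact: Prop_irrelevance.
Qed.

Lemma indices_inj k : injective (@indices k).
Proof.
move=> s t /eq_in_map st; apply: nerve_simplex_eq => i.
by apply: idx_inj; [exact: vertex_in|exact: vertex_in|apply: st; rewrite mem_enum].
Qed.

Lemma size_indices k (s : nerve_simplex V k) : size (indices s) = k.+1.
Proof. by rewrite size_codom card_ord. Qed.

(** Vertices of a simplex, even repeated, still meet in its common points. Coning off from a vertex
    produces such sequences. *)
Lemma indices_sub k (s : nerve_simplex V k) m (t : seq nat) :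
  size t = m.+1 -> {subset t <= indices s} ->
  exists2 u : nerve_simplex V m, indices u = t &
    (\bigcap_i s i `<=` \bigcap_i u i).
Proof.
move=> tm ts.
have /choice[j tj] (i : 'I_m.+1) : exists j, nth 0%N t i = idx (s j).
  by have /codomP[j ->] := ts _ (mem_nth 0%N (ltac:(by rewrite tm) : (i < size t)%N)); exists j.
have meet : \bigcap_i s (j i) !=set0.
  by have [x sx] := vertex_meet s; exists x => i _; exact: sx.
exists (NerveSimplex (fun i => vertex_in s (j i)) meet); last first.
  by move=> x sx i _; exact: sx.
apply: (@eq_from_nth _ 0%N) => [|i]; rewrite size_indices ?tm// => im.
rewrite /indices codomE (nth_map ord0) ?size_enum_ord//= -tj.
by rewrite nth_enum_ord.
Qed.

(** Moves cochains to index sequences, where the homotopy lives; [0] is a default off the nerve. *)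
Definition extend_cochain k (c : cochain V k) (t : seq nat) : int :=
  if pselect (exists s : nerve_simplex V k, indices s = t) is left h
  then c (sval (cid h)) else 0.

Lemma extend_cochainE k (c : cochain V k) s : extend_cochain c (indices s) = c s.
Proof.
rewrite /extend_cochain; case: pselect => [h|[]]; last by exists s.
by congr c; apply: indices_inj; rewrite (svalP (cid h)).
Qed.

Lemma coboundaryE k (f : seq nat -> int) (s : nerve_simplex V k.+1) :
  coboundary (fun t => f (indices t)) s = cobd f (indices s).
Proof. by rewrite /indices cobd_codom. Qed.

(* Simplices of dimension at least [N] have a repeated vertex, so [incr] vanishes
   on them. *)
Lemma cocycle_coboundary k N (c : cochain V k.+1) :
  (forall x s, uniq s -> (forall a, a \in s -> exists v, [/\ V v, idx v = a & v x]) ->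
    (size s <= N)%N) ->
  (N <= k.+1)%N -> coboundary c = 0 -> exists b, coboundary b = c.
Proof.
move=> ordV Nk c0; set f := extend_cochain c.
exists (fun t => homot f (indices t) k.+1); apply/funext => s.
rewrite (coboundaryE (fun t => homot f t k.+1)) -extend_cochainE -/f.
have := homotP f (size_indices s).
rewrite incr_eq0 ?size_indices// ?subr0 => [<-|]; last first.
  have [x sx] := vertex_meet s; apply/negP => us.
  suff : (size (indices s) <= N)%N by rewrite size_indices ltnNge Nk.
  apply: ordV us _ => _ /codomP[i ->].
  by exists (s i); split=> //; [exact: vertex_in|exact: sx].
rewrite -[LHS]add0r; congr (_ + _).
(* [cobd f] vanishes on sequences of vertices of [s], these being simplices and [c] a cocycle, so it
   has the homotopy of the zero function [f t - f t]. *)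
have -> : 0 = homot (fun t => f t - f t) (indices s) k.+2 by rewrite homotB subrr.
apply: eq_homot; rewrite ?size_indices// => t tk /(indices_sub tk)[u <- _].
rewrite subrr -coboundaryE -[LHS](_ : (0 : cochain V k.+2) u = 0)// -c0.
by apply: eq_bigr => i _; rewrite /f extend_cochainE.
Qed.

End nerve_simplices.

(** On a refinement [V] of order at most [N] the cocycle becomes a coboundary, so its class is that
    of zero on [V], which is also the restriction of zero from the trivial cover. *)
Theorem cech_vanishes_of_order (X : topologicalType) (N k : nat) :
  (forall U : set (set X), open_cover U -> exists W : nat -> set X,
    [/\ forall a, open (W a), forall x, exists a, W a x,
        forall a, exists2 u, U u & W a `<=` u &
        forall x s, uniq s -> (forall a, a \in s -> W a x) -> (size s <= N)%N]) ->
  (0 < N <= k)%N -> cech_cohomology_vanishes X k.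
Proof.
move=> cov /andP[N0 Nk] h.
case: k Nk h => [|k] Nk h; first by move: N0; rewrite ltnNge Nk.
rewrite -[h]reprK; case: (repr h) => {h} U oU c c0.
have [W [oW cW sW ordW]] := cov _ oU.
pose V := range W.
have oV : open_cover V.
  split=> [_ [a _ <-]//|]; apply/seteqP; split=> // x _.
  by have [a ax] := cW x; exists (W a) => //; exists a.
have z0 : coboundary (0 : cochain V k.+1) = 0.
  by apply/funext => s; rewrite /coboundary big1 // => i _; rewrite mulr0.
pose z := CechCocycle oV z0.
(* [W] may repeat sets; picking one index for each set makes [idx] injective on [V]. *)
have /choice[idx Widx] (v : set X) : exists a, V v -> W a = v.
  by have [[a _ av]|nv] := pselect (V v); [exists a|exists 0%N].
have /choice[p hp] (v : set X) : exists u, V v -> U u /\ v `<=` u.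
  have [[a _ <-]|nv] := pselect (V v); last by exists set0.
  by have [u Uu au] := sW a; exists u.
transitivity (\pi_({eq_quot (@cech_equiv X k.+1)}) z); apply/eqmodP/asboolP.
  apply: rst_step; exists p, hp => /=.
  have := @cocycle_coboundary X V idx _ k N (- pullback hp c); rewrite sub0r; apply.
  - by move=> v w Vv Vw vw; rewrite -(Widx v)// vw Widx.
  - move=> x s us sx; apply: (ordW x _ us) => a /sx[v [Vv <- vx]].
    by rewrite Widx.
  - exact: Nk.
  - apply/funext => s; rewrite /coboundary.
    transitivity (- coboundary c (refine_simplex hp s)); last by rewrite c0 oppr0.
    rewrite /coboundary -sumrN; apply: eq_bigr => i _; rewrite mulrN.
    by congr (- (_ * c _)); exact: nerve_simplex_eq.
apply/rst_sym/rst_step.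
have hT : refinement_map [set setT] V (fun=> setT) by move=> v _; split.
exists (fun=> setT), hT => /=; exists 0; rewrite /pullback.
by apply/funext => s; rewrite /coboundary big1 ?subrr// => i _; rewrite mulr0.
Qed.

(** * Box dimension and the order of covers *)

Lemma open_forall_lt (X : topologicalType) (P : nat -> set X) a :
  (forall b, open (P b)) -> open [set y | forall b, (b < a)%N -> P b y].
Proof.
move=> oP; elim: a => [|a IH].
  by rewrite (_ : mkset _ = setT) ?predeqE//; exact: openT.
rewrite (_ : mkset _ = P a `&` [set y | forall b, (b < a)%N -> P b y]).
  exact: openI.
rewrite predeqE => y; split=> [h|[ya h] b].
  by split=> [|b ba]; apply: h => //; exact: ltnW.
by rewrite ltnS leq_eqVlt => /predU1P[->//|/h].
Qed.

Lemma compact_finite_subcover (X : topologicalType) (f : X -> set X) :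
  compact [set: X] -> (forall x, open (f x)) -> (forall x, f x x) ->
  exists s : seq X, forall y, exists2 x, x \in s & f x y.
Proof.
move=> cX fo fx.
(* Finite sequences ordered by inclusion form a filter; compactness, as a near-covering property,
   gives one sequence good for all points. *)
pose F := filter_from setT (fun s0 : seq X => [set s : seq X | {subset s0 <= s}]).
have FF : Filter F.
  apply: filter_from_filter; first by exists [::].
  move=> s t _ _; exists (s ++ t) => // r /= str.
  by split=> x xs; apply: str; rewrite mem_cat xs ?orbT.
pose P (s : seq X) y := exists2 x, x \in s & f x y.
have [x _|s _ sP] := (iffLR (compact_near_coveringP _) cX) _ F P FF; last first.
  by exists s => y; exact: (sP s).
exists (f x, [set s : seq X | x \in s]) => /=; last by move=> [y s] [/= xy xs]; exists x.
split; first by apply: open_nbhs_nbhs; split.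
by exists [:: x] => // s /(_ x (mem_head _ _)).
Qed.

Lemma open_sublevel (R : realType) (X : topologicalType) (f : X -> R) t :
  continuous f -> open [set y | f y < t].
Proof.
move=> cf; apply: (@open_comp _ _ f [set z | z < t]); last exact: open_lt.
by move=> y _; exact: cf.
Qed.

Lemma open_superlevel (R : realType) (X : topologicalType) (f : X -> R) t :
  continuous f -> open [set y | t < f y].
Proof.
move=> cf; apply: (@open_comp _ _ f [set z | z > t]); last exact: open_gt.
by move=> y _; exact: cf.
Qed.

Definition box_dim_le (R : realType) (X : Type) (D : X -> X -> R) (n : nat) :=
  exists (C : nat) (L : R), forall m : nat, (0 < m)%N ->
    exists (T : finType) (l : X -> T), (#|T| <= C * m ^ n)%N /\
      forall x y, l x = l y -> D x y <= L / m%:R.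

(** [D x] sends the compact complement of [U] to a compact set of reals missing [0]. *)
Lemma compact_ball_sub (R : realType) (X : topologicalType) (D : X -> X -> R) :
  compact [set: X] -> (forall x, continuous (D x)) -> (forall x y, 0 <= D x y) ->
  (forall x y, D x y = 0 -> x = y) ->
  forall U x, open U -> U x -> exists2 c, 0 < c & forall y, D x y < c -> U y.
Proof.
move=> cX cD D0 sD U x oU Ux.
have cK : compact (D x @` ~` U).
  apply: continuous_compact; first exact/continuous_subspaceT.
  by apply: (subclosed_compact _ cX) => //; exact: open_closedC.
have clK := compact_closed (@Rhausdorff R) cK.
have : nbhs 0 (~` (D x @` ~` U)).
  apply: open_nbhs_nbhs; split; first exact: closed_openC.
  by move=> [y Uy /sD xy]; apply: Uy; rewrite -xy.
case/nbhs_ballP => c /= c0 hc; exists c => // y xyc.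
apply: contrapT => Uy; apply: (hc (D x y)); last by exists y.
by rewrite /ball /= sub0r normrN ger0_norm.
Qed.

(* Cover by balls whose radii are chosen so that the boundary spheres are in
   general position, no point being near [N] of them; then take differences of
   successive (slightly thickened) balls. *)
Theorem cover_order_box_dim (R : realType) (X : topologicalType) (x0 : X)
    (D : X -> X -> R) (N : nat) :
  compact [set: X] -> (forall x, continuous (D x)) -> (forall x y, 0 <= D x y) ->
  (forall x y, D x y = 0 -> x = y) -> (forall x, D x x = 0) ->
  (forall x y z, D x z <= D x y + D y z) ->
  box_dim_le D N -> forall U : set (set X), open_cover U ->
  exists W : nat -> set X,
    [/\ forall a, open (W a), forall x, exists a, W a x,
        forall a, exists2 u, U u & W a `<=` u &
        forall x s, uniq s -> (forall a, a \in s -> W a x) -> (size s <= N.+1)%N].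
Proof.
move=> cX cD D0 sD Dxx tD [C [L boxD]] U [oU cU].
have /choice[uc huc] x : exists uc : set X * R,
    [/\ U uc.1, 0 < uc.2 & forall y, D x y < uc.2 -> uc.1 y].
  have [u Uu ux] : (\bigcup_(u in U) u) x by rewrite cU.
  have [c c0 hc] := compact_ball_sub cX cD D0 sD (oU _ Uu) ux.
  by exists (u, c).
pose u x := (uc x).1; pose c x := (uc x).2.
have Uu x : U (u x) by have [] := huc x.
have c0 x : 0 < c x by have [] := huc x.
have cu x y : D x y < c x -> u x y by have [_ _] := huc x; apply.
have [s covs] : exists s : seq X, forall y, exists2 x, x \in s & [set y | D x y < c x / 2] y.
  apply: compact_finite_subcover => // x; last by rewrite /= Dxx divr_gt0.
  exact: open_sublevel.
set q := size s; pose x a := nth x0 s a.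
(* The radii around [x a] will lie between [c (x a) / 2] and [c (x a)]; [eta] fits in this range for
   every [a]. *)
have [eta eta0 etac] : exists2 eta, 0 < eta & forall a, (a < q)%N -> eta <= c (x a) / 2.
  exists (\big[Num.min/1]_(a < q) (c (x a) / 2)).
    elim/big_ind: _ => [//|y z ypos zpos|a _]; first by rewrite lt_min ypos.
    exact: divr_gt0.
  by move=> a aq; rewrite (bigD1 (Ordinal aq))//= ge_min lexx.
(* Pieces at scale [m * e] have diameter at most [eta / m], the width of one shell. *)
have [e e0 Le] : exists2 e : nat, (0 < e)%N & L / eta <= e%:R.
  exists (Num.truncn (L / eta)).+1 => //; apply/ltW; exact: truncnS_gt.
(* Large enough for [C * (m * e) ^ N * 4 ^ q < m ^ N.+1]. *)
pose m := (C * e ^ N * 4 ^ q).+1.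
have [T [l [cardT hl]]] := boxD (m * e)%N ltac:(by rewrite muln_gt0).
have mR0 : 0 < m%:R :> R by rewrite ltr0n.
have diam y z : l y = l z -> D y z <= eta / m%:R.
  move=> /hl/le_trans; apply; rewrite natrM invfM mulrCA mulrC ler_pM2r ?invr_gt0//.
  by rewrite ler_pdivrMr ?ltr0n// mulrC -ler_pdivrMr.
pose lo a (k : nat) := c (x a) / 2 + eta / m%:R * k%:R.
pose near_sphere a k y := lo a k < D (x a) y < lo a k.+1.
pose hit t (a : 'I_q) (i : 'I_m) := `[< exists y, l y = t /\ near_sphere a i y >].
have [||k hk] := @exists_general_position q m N.+1 T hit isT.
- move=> t a; apply: card_close_ord => i j; rewrite !inE.
  move=> [y [<- /andP[iy yi]]] [z [zy /andP[jz zj]]].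
  have yz : D (x a) z <= D (x a) y + eta / m%:R.
    by apply: (le_trans (tD _ y _)); rewrite lerD2l diam.
  have : (lo a j < lo a i.+2).
    apply: (lt_le_trans jz); apply: (le_trans yz); rewrite /lo.
    by rewrite -[i.+2%:R]natr1 mulrDr mulr1 addrA lerD2r ltW.
  rewrite /lo ltrD2l ltr_pM2l ?divr_gt0// ltr_nat; lia.
- apply: (@leq_ltn_trans (C * (m * e) ^ N * 4 ^ q)); first by rewrite leq_mul2r cardT orbT.
  have -> : (C * (m * e) ^ N * 4 ^ q = C * e ^ N * 4 ^ q * m ^ N)%N.
    by rewrite expnMn; ring.
  by rewrite expnS ltn_pmul2r ?expn_gt0.
pose ki a := if insub a is Some i then val (k i) else 0%N.
have kiE (a : 'I_q) : ki a = k a by rewrite /ki valK.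
(* The outer ball of [a] minus the closed inner balls of earlier indices: if [b < a], a point of
   both [W a] and [W b] lies in the chosen shell around [x b]. *)
pose W a := if (a < q)%N then [set y | D (x a) y < lo a (ki a).+1] `&`
  [set y | forall b, (b < a)%N -> lo b (ki b) < D (x b) y] else set0.
have ltlo a i : lo a i < lo a i.+1.
  by rewrite /lo ltrD2l ltr_pM2l ?divr_gt0// ltr_nat.
exists W; split=> [a|y|a|y r ur rW].
- rewrite /W; case: ifP => _; last exact: open0.
  apply: openI; first exact: open_sublevel.
  apply: open_forall_lt => b.
  exact: open_superlevel.
(* The first outer ball containing [y] gives the member through [y]. *)
- have ex : exists a, (a < q)%N && (D (x a) y < lo a (ki a).+1).
    have [z zs zy] := covs y; exists (index z s); rewrite index_mem zs /x nth_index//=.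
    by apply: (lt_le_trans zy); rewrite /lo /x nth_index// lerDl mulr_ge0// divr_ge0// ltW.
  case: (ex_minnP ex) => a /andP[aq ya] amin; exists a; rewrite /W aq; split=> //= b ba.
  apply: (lt_le_trans (ltlo _ _)); rewrite leNgt; apply/negP => yb.
  by have := amin b; rewrite (ltn_trans ba aq) yb leqNgt ba => /(_ isT).
- case: (ltnP a q) => aq; last first.
    by exists (u x0); rewrite /W ?ltnNge ?aq//; exact: sub0set.
  exists (u (x a)); rewrite /W ?aq// => y [/= ya _]; apply: cu; apply: (lt_le_trans ya).
  rewrite /lo [leRHS]splitr lerD2l -[X in ki X]/(val (Ordinal aq)) kiE.
  rewrite -mulrA; apply: le_trans (etac _ aq); rewrite ger_pMr// mulrC ler_pdivrMr// mul1r.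
  by rewrite ler_nat ltn_ord.
(* An index of [r] whose inner ball contains [y] must be the largest, so there is at most one; the
   others have [y] in their shells, and there are at most [N] of them. *)
- pose low a := D (x a) y <= lo a (ki a).
  rewrite -(count_predC low); apply: (@leq_add _ _ 1 N).
    rewrite -size_filter; have := filter_uniq low ur.
    have : {in [seq a <- r | low a] &, forall a b, (a <= b)%N}.
      move=> a b; rewrite !mem_filter => /andP[la ar] /andP[lb br].
      rewrite leqNgt; apply/negP => ba.
      have := rW _ ar; rewrite /W; case: ifP => // _ [_ /(_ b ba)].
      by rewrite ltNge -/(low b) lb.
    case: (seq.filter low r) => [|a [|b t]] // h /=; rewrite inE negb_or => /andP[/andP[ab _] _].
    exfalso; move/negP: ab; apply; rewrite eqn_leq !h ?inE ?eqxx ?orbT//.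
  rewrite -ltnS; apply: (leq_ltn_trans _ (hk (l y))).
  rewrite -size_filter cardE -(size_map val).
  apply: uniq_leq_size; first exact: filter_uniq.
  move=> a; rewrite mem_filter /= /low -ltNge => /andP[ya ar].
  have := rW _ ar; rewrite /W; case: ifP => // aq [/= ay _].
  apply/mapP; exists (Ordinal aq) => //; rewrite mem_enum finset.in_set.
  apply: asboolT; exists y; split=> //; rewrite -kiE; exact/andP.
Qed.

(** * Box dimension of a compact Riemannian manifold *)

(** The integral is a supremum over simple functions below the integrand. This spares the
    measurability of speeds and of [mdist] on a product. *)
Lemma ge0_le_integral_nonmeasurable d (T : measurableType d) (R : realType)
    (mu : {measure set T -> \bar R}) (D : set T) (f g : T -> \bar R) :
  (forall x, D x -> (0 <= f x)%E) -> (forall x, D x -> (f x <= g x)%E) ->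
  (\int[mu]_(x in D) f x <= \int[mu]_(x in D) g x)%E.
Proof.
move=> f0 fg; rewrite !ge0_integralE//; last first.
  by move=> x Dx; apply: le_trans (fg _ Dx); exact: f0.
apply: ereal_sup_le => _ [h hf <-]; exists h => // x.
apply: le_trans (hf x) _; rewrite /patch; case: ifP => //.
by rewrite inE; exact: fg.
Qed.

Section mx.
Variable R : realType.

Lemma mx_entry_le m n (x : 'M[R]_(m, n)) i j : `|x i j| <= `|x|.
Proof.
rewrite [leRHS]/Num.norm /= mx_normrE; apply/bigmax_geP; right => /=.
by exists (i, j).
Qed.

Lemma mx_norm_le m n (x : 'M[R]_(m, n)) e : 0 <= e ->
  (forall i j, `|x i j| <= e) -> `|x| <= e.
Proof.
move=> e0 h; rewrite [leLHS]/Num.norm /= mx_normrE; apply/bigmax_leP.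
by split=> // -[i j] _; exact: h.
Qed.

Lemma quadratic_le n (v : 'rV[R]_n) (G : 'M[R]_n) :
  (v *m G *m v^T) 0 0 <= n%:R ^+ 2 * `|G| * `|v| ^+ 2.
Proof.
rewrite mxE; apply: (@le_trans _ _ (\sum_(j < n) n%:R * `|G| * `|v| ^+ 2)).
  apply: ler_sum => j _; rewrite !mxE mulr_suml.
  apply: (@le_trans _ _ (\sum_(k < n) `|G| * `|v| ^+ 2)).
    apply: ler_sum => k _; apply: (le_trans (ler_norm _)).
    have -> : `|v 0 k * G k j * v 0 j| = `|G k j| * (`|v 0 k| * `|v 0 j|).
      by rewrite !normrM; ring.
    by rewrite expr2 !ler_pM// ?mulr_ge0// mx_entry_le.
  by rewrite sumr_const card_ord -[in leLHS]mulr_natl mulrA.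
by rewrite sumr_const card_ord -[leLHS]mulr_natl expr2 !mulrA.
Qed.

End mx.

Section segment.
Context {R : realType} {n : nat} {M : topologicalType}.
Variables (A : smooth_atlas R n M) (g : riemannian_metric A) (i : chart A).
Variables (y v : 'rV[R]_n).

Let O := coord i @` dom i.
Let line (t : R) : 'rV[R]_n := y + t *: v.
Let c := param i \o line.

Lemma continuous_line : continuous line.
Proof.
move=> t; apply: cvgD; first exact: cvg_cst.
by apply: cvgZr_tmp; exact: cvg_id.
Qed.

Lemma diff_line t : differentiable line t /\ 'd line t 1 = v.
Proof.
have did : differentiable (@id R) t by [].
have dZ := differentiableZl v did; have dc := differentiable_cst y t.
have -> : line = cst y + (fun z : R => z *: v) by [].
split; first exact: differentiableD.
apply: (etrans (congr1 (fun f : R -> 'rV[R]_n => f 1) (diffD dc dZ))).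
have E2 := congr1 (fun f : R -> 'rV[R]_n => f 1) (diffZl v did).
have E3 := congr1 (fun f : R -> 'rV[R]_n => f 1) (diff_cst y t : _ = _ :> (R -> _)).
apply: (etrans (congr2 +%R E3 E2)).
apply: (etrans (add0r _)); rewrite diff_val; exact: scale1r.
Qed.

Lemma dom_param z : O z -> dom i (param i z) /\ coord i (param i z) = z.
Proof. by move=> [x dx <-]; rewrite coordK. Qed.

Lemma continuous_segment t : O (line t) -> {for t, continuous c}.
Proof.
by move=> Ot; apply: continuous_comp; [exact: continuous_line|exact: param_continuous].
Qed.

Lemma coord_segment (j : chart A) u : (coord i @` (dom i `&` dom j)) (line u) ->
  derivable (coord j \o c) u 1 /\
  derive1 (coord j \o c) u = 'D_v (coord j \o param i) (line u).
Proof.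
move=> Ou; have [/(_ _ Ou) dF _] := @transition_smooth _ _ _ A i j 1%N.
have [dl lv] := diff_line u.
have dFl : differentiable ((coord j \o param i) \o line) u by exact: differentiable_comp.
split; first exact/derivable1_diffP.
by rewrite derive1E'// [LHS](_ : _ = 'd ((coord j \o param i) \o line) u 1)// diff_comp//= lv deriveE.
Qed.

Lemma near_overlap (j : chart A) t : O (line t) -> dom j (c t) ->
  \forall u \near t, (coord i @` (dom i `&` dom j)) (line u).
Proof.
move=> Ot jt.
have Ou : \forall u \near t, O (line u).
  by apply: continuous_line; apply: open_nbhs_nbhs; split=> //; exact: coord_open.
have ju : \forall u \near t, dom j (c u).
  by apply: (continuous_segment Ot); apply: open_nbhs_nbhs; split=> //; exact: dom_open.
apply: filterS2 Ou ju => u /dom_param[iu cu] ju.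
by exists (c u).
Qed.

(** In a chart [j] the velocity is a directional derivative of the transition map, continuous by
    smoothness. *)
Lemma C1_segment t : O (line t) -> {for t, continuous c} /\
  forall j : chart A, dom j (c t) ->
    (\forall u \near t, derivable (coord j \o c) u 1) /\
    {for t, continuous (derive1 (coord j \o c))}.
Proof.
move=> Ot; split; first exact: continuous_segment.
move=> j jt; have near_t := near_overlap Ot jt; split.
  by apply: filterS near_t => u /coord_segment[].
have := nbhs_singleton near_t => Ott.
have [_ /(_ v)/(_ _ Ott) cD] := @transition_smooth _ _ _ A i j 1%N.
rewrite /prop_for /continuous_at (coord_segment Ott).2.
have lc : (fun u => 'D_v (coord j \o param i) (line u)) @ t -->
    'D_v (coord j \o param i) (line t).
  apply: (@continuous_comp _ _ _ line (fun w => 'D_v (coord j \o param i) w) t) => //.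
  exact: continuous_line.
apply: cvg_trans lc; apply: near_eq_cvg.
by apply: filterS near_t => u /coord_segment[_ ->].
Qed.

(** [speed] uses the chart chosen at [c t]; [gram_transition] carries the norm back to the chart
    [i], where the velocity is constantly [v]. *)
Lemma speed_segment t : O (line t) ->
  speed g c t = Num.sqrt ((v *m gram g i (c t) *m v^T) 0 0).
Proof.
move=> Ot; rewrite /speed; set j := chart_at A (c t).
have jt : dom j (c t) by exact: dom_chart_at.
have Ott := nbhs_singleton (near_overlap Ot jt).
have [it ct] := dom_param Ot.
have [_ ->] := coord_segment Ott.
rewrite deriveEjacobian; last by have [dF _] := @transition_smooth _ _ _ A i j 1%N; exact: dF.
have := gram_transition g it jt; rewrite /= ct => ->.
by rewrite trmx_mul !mulmxA.
Qed.

End segment.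

Section lipschitz.
Context {R : realType} {n : nat} {M : topologicalType}.
Variables (A : smooth_atlas R n M) (g : riemannian_metric A).

(** The straight segment in the chart competes in the infimum, and [B] bounds its speed. *)
Lemma geodesic_dist_chart (i : chart A) (y0 : 'rV[R]_n) (rho B : R) (y z : 'rV[R]_n) :
  (forall w, ball y0 (rho *+ 2) w ->
    (coord i @` dom i) w /\ `|gram g i (param i w)| <= B) ->
  ball y0 rho y -> ball y0 rho z ->
  (geodesic_dist g (param i y) (param i z) <=
   (n%:R * Num.sqrt B * `|z - y|)%:E)%E.
Proof.
move=> hB; rewrite -!ball_normE /= => y0y y0z.
pose l (t : R) := y + t *: (z - y).
(* The curve must be C^1 on an open interval around [[0, 1]]; on this one [|1 - t| + |t| < 2], hence
   the doubled ball. *)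
have lB t : -2^-1 < t < 3 / 2 -> ball y0 (rho *+ 2) (l t).
  move=> /andP[t0 t1]; rewrite -ball_normE /= /l.
  have -> : y0 - (y + t *: (z - y)) = (1 - t) *: (y0 - y) + t *: (y0 - z).
    by rewrite !scalerBr !scalerBl !scale1r; apply/rowP => k; rewrite !mxE; ring.
  apply: (le_lt_trans (ler_normD _ _)); rewrite !normrZ.
  have rho0 : 0 < rho by apply: le_lt_trans y0y.
  apply: (@lt_le_trans _ _ (`|1 - t| * rho + `|t| * rho)); last first.
    rewrite -mulrDl -mulr_natl ler_pM2r//.
    by case: (ger0P t) => ?; case: (ger0P (1 - t)) => ?; lra.
  have [t00|t00] := eqVneq t 0.
    by rewrite t00 subr0 normr1 normr0 !mul0r !addr0 !mul1r.
  by rewrite ler_ltD ?ltr_pM2l ?normr_gt0// ler_wpM2l// ltW.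
have lO t : -2^-1 < t < 3 / 2 -> (coord i @` dom i) (l t) by move=> /lB/hB[].
set c := param i \o l.
have c01 : piecewise_C1 A c.
  split.
    apply: continuous_in_subspaceT => t; rewrite inE /= in_itv /= => /andP[t0 t1].
    apply: (@continuous_segment _ _ _ A i y (z - y) t); apply: lO; lra.
  exists 1%N, (fun k => k%:R); split=> // -[|//] _; split; first exact: ltr01.
  exists (-2^-1), (3/2), c; split => //; [lra|lra|].
  move=> t /=; rewrite in_itv /= => t01.
  by apply: (@C1_segment _ _ _ A i y (z - y) t); exact: lO.
have len : (curve_length g c <= (n%:R * Num.sqrt B * `|z - y|)%:E)%E.
  have -> : ((n%:R * Num.sqrt B * `|z - y|)%:E =
      \int[lebesgue_measure]_(t in `[0%R, 1%R]) (cst (n%:R * Num.sqrt B * `|z - y|)%:E t))%E.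
    have m1 : lebesgue_measure (`[0, 1]%classic : set R) = 1%E.
      by rewrite lebesgue_measure_itv /= lte_fin ltr01 oppr0 adde0.
    by rewrite integral_cst// -[LHS]mule1 -m1.
  apply: ge0_le_integral_nonmeasurable => t /=; rewrite in_itv/= => /andP[t0 t1].
    by rewrite lee_fin sqrtr_ge0.
  have t2 : -2^-1 < t < 3 / 2 by lra.
  rewrite lee_fin (@speed_segment _ _ _ A g i y (z - y) t); last exact: lO.
  have [_ /= gB] := hB _ (lB _ t2).
  have -> : n%:R * Num.sqrt B * `|z - y| = Num.sqrt (n%:R ^+ 2 * B * `|z - y| ^+ 2).
    rewrite sqrtrM ?mulr_ge0 ?exprn_ge0 ?(le_trans _ gB)// sqrtrM ?exprn_ge0//.
    by rewrite !sqrtr_sqr normr_id normr_nat.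
  rewrite ler_wsqrtr//; apply: (le_trans (quadratic_le _ _)).
  by rewrite ler_wpM2r ?exprn_ge0// ler_wpM2l ?exprn_ge0.
apply: le_trans len; apply: ereal_inf_lbound; exists c => //; split=> //.
- by rewrite /c /l /= scale0r addr0.
- by rewrite /c /l /= scale1r addrC subrK.
Qed.

End lipschitz.

(** [[-1, 1]] is shifted to [[0, 2]] and cut into steps of length [1 / m]; the endpoint [1] takes
    the extra cell [2 * m]. *)
Definition cell {R : realType} (m : nat) (t : R) : 'I_(2 * m).+1 :=
  inord (Num.truncn (m%:R * (t + 1))).

Lemma cell_eq (R : realType) m (s t : R) : (0 < m)%N -> `|s| <= 1 -> `|t| <= 1 ->
  cell m s = cell m t -> `|s - t| <= 1 / m%:R.
Proof.
move=> m0 s1 t1; have mR : 0 < m%:R :> R by rewrite ltr0n.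
have bnd (u : R) : `|u| <= 1 -> 0 <= m%:R * (u + 1) /\
    (Num.truncn (m%:R * (u + 1)) < (2 * m).+1)%N.
  rewrite ler_norml => /andP[u0 u1].
  have u00 : 0 <= m%:R * (u + 1) by rewrite mulr_ge0 ?(ltW mR)//; lra.
  split=> //; rewrite truncn_lt_nat// -natr1 natrM.
  have : m%:R * (u + 1) <= m%:R * 2 by rewrite ler_pM2l//; lra.
  lra.
have [s0 /inordK sm] := bnd _ s1; have [t0 /inordK tm] := bnd _ t1.
move=> /(congr1 val) /=; rewrite sm tm => st.
have /andP[sa sb] := truncn_itv s0; have /andP[ta tb] := truncn_itv t0.
rewrite -st -natr1 in ta tb; rewrite -natr1 in sb.
have : `|m%:R * (s - t)| <= 1.
  by rewrite ler_norml mulrBr; apply/andP; split; lra.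
by rewrite normrM gtr0_norm// ler_pdivlMr// mulrC.
Qed.

Section box_dim_manifold.
Context {R : realType} {n : nat} {M : pmetricType R}.
Variables (A : smooth_atlas R n M) (g : riemannian_metric A).
Hypothesis M_geodesic : forall x y : M, (mdist x y)%:E = geodesic_dist g x y.

(** Near [x] the Gram matrix is bounded by continuity; the chart is centred and rescaled into the
    unit ball so that [cell] applies. *)
Lemma local_lipschitz_chart (x : M) : exists (V : set M) (f : M -> 'rV[R]_n) (K : R),
  [/\ open V, V x, 0 <= K, forall y, V y -> `|f y| <= 1 &
    forall y z, V y -> V z -> mdist y z <= K * `|f z - f y|].
Proof.
pose i := chart_at A x; have ix : dom i x := dom_chart_at A x.
pose y0 := coord i x; have Oy0 : (coord i @` dom i) y0 by exists x.
pose B := `|gram g i (param i y0)| + 1.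
have nO : \forall w \near y0, (coord i @` dom i) w.
  by apply: open_nbhs_nbhs; split=> //; exact: coord_open.
have nB : \forall w \near y0, `|gram g i (param i w)| <= B.
  have /= cG := @gram_smooth _ _ _ A g i 0%N _ Oy0.
  by apply: (@cvgr_norm_le _ _ _ _ _ _ _ cG); rewrite ltrDl.
have /nbhs_ballP[e /= e0 he] : nbhs y0 [set w | (coord i @` dom i) w /\
    `|gram g i (param i w)| <= B] by apply: filterS2 nO nB.
pose rho := e / 2; have rho0 : 0 < rho by rewrite divr_gt0.
have rho2 : rho *+ 2 = e by rewrite -mulr_natr divfK.
exists (dom i `&` coord i @^-1` ball y0 rho), (fun y => rho^-1 *: (coord i y - y0)),
  (n%:R * Num.sqrt B * rho); split.
- rewrite openE => y [iy yB]; apply: filterI.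
    by apply: open_nbhs_nbhs; split=> //; exact: dom_open.
  apply: (coord_continuous iy); apply: open_nbhs_nbhs; split=> //.
  exact: ball_open.
- by split=> //; exact: ballxx.
- by rewrite !mulr_ge0// ?ltW// sqrtr_ge0.
- move=> y [_]; rewrite /= -ball_normE /= => yB.
  rewrite normrZ normfV gtr0_norm// mulrC ler_pdivrMr// mul1r distrC; exact: ltW.
move=> y z [iy yB] [iz zB]; rewrite -scalerBr opprB addrA subrK normrZ normfV gtr0_norm//.
rewrite mulrA mulfK ?gt_eqF// -lee_fin M_geodesic.
rewrite -{1}(coordK iy) -{1}(coordK iz).
by apply: (@geodesic_dist_chart _ _ _ A g i y0 rho B) => //; rewrite rho2.
Qed.

(** A point is labelled by one of finitely many charts and the cells of its [n] coordinates there;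
    [3 ^ n] comes from [2 * m + 1 <= 3 * m]. *)
Lemma box_dim_manifold : compact [set: M] -> box_dim_le (fun x y : M => mdist x y) n.
Proof.
move=> cM.
have /choice[V hV] := local_lipschitz_chart; have {hV}/choice[f hV] := hV.
have {hV}/choice[K hV] := hV.
have [x|x|s covs] := @compact_finite_subcover M V cM; [by have [] := hV x|by have [] := hV x|].
have /choice[a ha] (z : M) : exists a, (a < size s)%N /\ V (nth point s a) z.
  by have [x xs Vz] := covs z; exists (index x s); rewrite index_mem xs nth_index.
pose x a := nth point s a.
exists ((size s).+1 * 3 ^ n)%N, (\sum_(x <- s) K x) => m m0.
exists ('I_(size s).+1 * {ffun 'I_n -> 'I_(2 * m).+1})%type.
exists (fun z => (inord (a z), [ffun k => cell m (f (x (a z)) z 0 k)])); split.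
  rewrite card_prod card_ffun !card_ord -mulnA leq_mul2l/= -expnMn.
  by case: n => // n'; rewrite leq_exp2r//; lia.
move=> y z [/(congr1 val)]; have [ya Vy] := ha y; have [za Vz] := ha z.
rewrite /= !inordK ?ltnS 1?ltnW// => yz; rewrite -yz in za Vz * => /ffunP cyz.
have [_ _ K0 f1 fK] := hV (x (a y)).
apply: (le_trans (fK y z Vy Vz)).
apply: (@le_trans _ _ (K (x (a y)) * (1 / m%:R))).
  apply: ler_wpM2l => //; apply: mx_norm_le; first by rewrite divr_ge0.
  move=> i j; rewrite ord1 !mxE distrC; apply: cell_eq => //.
  - by apply: le_trans (f1 _ Vy); exact: mx_entry_le.
  - by apply: le_trans (f1 _ Vz); exact: mx_entry_le.
  - by have := cyz j; rewrite !ffunE.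
rewrite mulrA mulr1 ler_pM2r ?invr_gt0 ?ltr0n//.
rewrite (big_nth point) big_mkord (bigD1 (Ordinal ya))//= lerDl sumr_ge0// => j _.
by have [] := hV (nth point s j).
Qed.

End box_dim_manifold.

(** * Discrete measures and the Wasserstein distance *)

Section discrete_measures.
Import HBNNSimple.
Context d (T : measurableType d) (R : realType).

Definition discrete_sum (I : finType) (w : I -> R) (z : I -> T) (B : set T) : \bar R :=
  (\sum_i (w i)%:E * \d_(z i) B)%E.

Lemma exists_discrete_measure (I : finType) (w : I -> R) (z : I -> T) :
  (forall i, 0 <= w i) -> exists m : {measure set T -> \bar R},
    (forall B, m B = discrete_sum w z B) /\
    forall f : T -> R, measurable_fun setT f -> (forall x, 0 <= f x) ->
      (\int[m]_x (f x)%:E = (\sum_i w i * f (z i))%:E)%E.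
Proof.
move=> w0.
pose m_ (k : nat) : {measure set T -> \bar R} :=
  if (insub k : option 'I_#|I|) is Some i
  then mscale (NngNum (w0 (enum_val i))) (dirac (z (enum_val i))) else mzero.
exists (msum m_ #|I|); split.
  move=> B; rewrite /= /msum /discrete_sum.
  rewrite [RHS](reindex _ (onW_bij _ (@enum_val_bij I))) /=.
  by apply: eq_bigr => i _; rewrite /m_ valK.
move=> f mf f0; have mf' : measurable_fun setT (fun x => (f x)%:E) by exact/measurable_EFinP.
have f0' x : setT x -> (0 <= (f x)%:E)%E by rewrite lee_fin.
rewrite ge0_integral_measure_sum// -sumEFin.
rewrite [RHS](reindex _ (onW_bij _ (@enum_val_bij I))) /=.
apply: eq_bigr => i _; rewrite /m_ valK ge0_integral_mscale//= integral_dirac//.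
by rewrite diracT mul1e EFinM.
Qed.

Lemma discrete_integral (I : finType) (w : I -> R) (z : I -> T)
    (mu : {measure set T -> \bar R}) (f : T -> R) : (forall i, 0 <= w i) ->
  (forall B, measurable B -> mu B = discrete_sum w z B) ->
  measurable_fun setT f -> (forall x, 0 <= f x) ->
  (\int[mu]_x (f x)%:E = (\sum_i w i * f (z i))%:E)%E.
Proof.
move=> w0 muE mf f0; have [m [mE <-//]] := exists_discrete_measure z w0.
by apply: eq_measure_integral => B mB _; rewrite mE muE.
Qed.

(** Simple functions below [f] are measurable and bounded by [f] at the atoms. This serves for the
    cost of a coupling. *)
Lemma discrete_integral_le (I : finType) (w : I -> R) (z : I -> T)
    (mu : {measure set T -> \bar R}) (f : T -> R) : (forall i, 0 <= w i) ->
  (forall B, measurable B -> mu B = discrete_sum w z B) -> (forall x, 0 <= f x) ->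
  (\int[mu]_x (f x)%:E <= (\sum_i w i * f (z i))%:E)%E.
Proof.
move=> w0 muE f0; rewrite ge0_integralTE; last by move=> x; rewrite lee_fin.
apply: ge_ereal_sup => _ [h /= hf <-].
have <- : (\int[mu]_x (h x)%:E = sintegral mu h)%E by rewrite integral_nnsfun// patch_setT.
rewrite (discrete_integral w0 muE)// lee_fin; apply: ler_sum => i _.
by rewrite ler_wpM2l// -lee_fin hf.
Qed.

Lemma exists_discrete_probability (I : finType) (w : I -> R) (z : I -> T) :
  (forall i, 0 <= w i) -> \sum_i w i = 1 -> exists P : probability T R,
    forall B, P B = discrete_sum w z B.
Proof.
move=> w0 w1; have [m [mE _]] := exists_discrete_measure z w0.
have m1 : m setT = 1%E.
  rewrite mE /discrete_sum; under eq_bigr do rewrite diracT mule1.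
  by rewrite sumEFin w1.
exists (mnormalize m (dirac point)) => B.
by rewrite /= /mnormalize /= m1 onee_eq0 /= invr1 mule1 mE.
Qed.

Lemma eq_probability (P Q : probability T R) :
  (P = Q :> (set T -> \bar R)) -> P = Q.
Proof.
move: P Q => [P [[p1 p2] [p3] [p4] [p5] [p6] [p7] [p8]]].
move=> [Q [[+ +] [+] [+] [+] [+] [+] [+]]] /= PQ; rewrite -{}PQ => q1 q2 q3 q4 q5 q6 q7 q8.
by rewrite (Prop_irrelevance q1 p1) (Prop_irrelevance q2 p2) (Prop_irrelevance q3 p3)
  (Prop_irrelevance q4 p4) (Prop_irrelevance q5 p5) (Prop_irrelevance q6 p6)
  (Prop_irrelevance q7 p7) (Prop_irrelevance q8 p8).
Qed.

End discrete_measures.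

Section wasserstein.
Context {R : realType} {X : pmetricType R}.

Lemma measurable_borel (f : X -> R) : continuous f ->
  measurable_fun setT (f : borel X -> R).
Proof.
move=> /continuousP cf; apply: (measurability _ (RGenOpens.measurableE R)).
move=> _ [_ [a [b ->] <-]]; rewrite setTI; apply: sub_sigma_algebra.
exact/cf/interval_open.
Qed.

(** Values in [[0, 1]] keep expectations bounded and make the class stable under [1 - f]. *)
Definition lip1 (f : X -> R) : Prop :=
  (forall x y, f x - f y <= mdist x y) /\ forall x, 0 <= f x <= 1.

Lemma lip1_norm f x y : lip1 f -> `|f x - f y| <= mdist x y.
Proof.
move=> [lf _]; rewrite ler_norml lf andbT lerNl opprB (le_trans (lf _ _))//.
by rewrite metric_sym.
Qed.

Lemma lip1_continuous f : lip1 f -> continuous f.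
Proof.
move=> lf x; apply/cvgrPdist_lt => e e0.
have : nbhs x (ball x e) by exact: nbhsx_ballx.
apply: filterS => y; rewrite ballEmdist /=; apply: le_lt_trans.
exact: lip1_norm.
Qed.

Lemma lip1_onem f : lip1 f -> lip1 (fun x => 1 - f x).
Proof.
move=> lf; split=> [x y|x]; last by have [_ /(_ x)] := lf; lra.
rewrite opprB addrCA addrAC subrr add0r.
by rewrite (le_trans (ler_norm _))// metric_sym lip1_norm.
Qed.

(** The easy half of Kantorovich duality. The positive part of [f z.1 - f z.2] is at most the
    distance and keeps all integrands nonnegative. *)
Lemma W1_ge_sub (I J : finType) (w : I -> R) (x : I -> X) (w' : J -> R) (x' : J -> X)
    (mu nu : probability (borel X) R) f : lip1 f ->
  (forall i, 0 <= w i) -> (forall i, 0 <= w' i) ->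
  (forall B, mu B = discrete_sum w (x : I -> borel X) B) ->
  (forall B, nu B = discrete_sum w' (x' : J -> borel X) B) ->
  ((\sum_i w i * f (x i) - \sum_i w' i * f (x' i))%:E <= W1 mu nu)%E.
Proof.
move=> lf w0 w0' muE nuE; apply: le_ereal_inf_tmp => _ [pi cpi <-].
have f0 y : 0 <= f y by have [_ /(_ y)/andP[]] := lf.
have mf : measurable_fun setT (f : borel X -> R) := measurable_borel (lip1_continuous lf).
have mfE : measurable_fun setT (fun y : borel X => (f y)%:E) by exact/measurable_EFinP.
have f0E : {in setT, forall y : borel X, (0 <= (f y)%:E)%E} by move=> y _; rewrite lee_fin.
have mf1 : measurable_fun setT (fun z : borel X * borel X => f z.1).
  exact: measurableT_comp.
have mf2 : measurable_fun setT (fun z : borel X * borel X => f z.2).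
  exact: measurableT_comp.
pose h (z : borel X * borel X) := Num.max 0 (f z.1 - f z.2).
have mh : measurable_fun setT h.
  by apply: measurable_maxr => //; exact: measurable_funB.
have E1 : (\int[pi]_z (f z.1)%:E = (\sum_i w i * f (x i))%:E)%E.
  rewrite -(discrete_integral w0 (fun B _ => muE B) mf f0).
  have := @ge0_integral_pushforward _ _ _ _ R fst measurable_fst pi setT
    (fun y => (f y)%:E) measurableT.
  rewrite preimage_setT => /(_ mfE f0E) <-.
  apply: eq_measure_integral => B mB _; rewrite /= /pushforward.
  have [<- _] := cpi B mB; congr (pi _).
  by apply/seteqP; split=> z //= [].
have E2 : (\int[pi]_z (f z.2)%:E = (\sum_i w' i * f (x' i))%:E)%E.
  rewrite -(discrete_integral w0' (fun B _ => nuE B) mf f0).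
  have := @ge0_integral_pushforward _ _ _ _ R snd measurable_snd pi setT
    (fun y => (f y)%:E) measurableT.
  rewrite preimage_setT => /(_ mfE f0E) <-.
  apply: eq_measure_integral => B mB _; rewrite /= /pushforward.
  have [_ <-] := cpi B mB; congr (pi _).
  by apply/seteqP; split=> z //= [].
apply: (@le_trans _ _ (\int[pi]_z (h z)%:E)%E); last first.
  apply: ge0_le_integral_nonmeasurable => z _; rewrite lee_fin /h.
    by rewrite le_max lexx.
  by rewrite ge_max mdist_ge0 /=; exact: lf.1.
have : (\int[pi]_z (f z.1)%:E <= \int[pi]_z ((h z)%:E + (f z.2)%:E))%E.
  apply: ge0_le_integral_nonmeasurable => z _; rewrite lee_fin//.
  by rewrite -lerBlDr le_max lexx orbT.
rewrite (ge0_integralD pi measurableT); [|by move=> z _; rewrite lee_fin le_max lexx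
  |exact/measurable_EFinP|by move=> z _; rewrite lee_fin|exact/measurable_EFinP].
by rewrite E1 E2 EFinB leeBlDr.
Qed.

(** Applying [W1_ge_sub] to [f] and to [1 - f] gives both signs. *)
Lemma W1_ge (I J : finType) (w : I -> R) (x : I -> X) (w' : J -> R) (x' : J -> X)
    (mu nu : probability (borel X) R) f : lip1 f ->
  (forall i, 0 <= w i) -> (forall i, 0 <= w' i) ->
  \sum_i w i = 1 -> \sum_i w' i = 1 ->
  (forall B, mu B = discrete_sum w (x : I -> borel X) B) ->
  (forall B, nu B = discrete_sum w' (x' : J -> borel X) B) ->
  ((`|\sum_i w i * f (x i) - \sum_i w' i * f (x' i)|)%:E <= W1 mu nu)%E.
Proof.
move=> lf w0 w0' w1 w1' muE nuE.
have onem (K : finType) (u : K -> R) (y : K -> X) : \sum_i u i = 1 ->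
    \sum_i u i * (1 - f (y i)) = 1 - \sum_i u i * f (y i).
  by move=> u1; rewrite -[in RHS]u1 -sumrB; apply: eq_bigr => i _; rewrite mulrBr mulr1.
have := W1_ge_sub (lip1_onem lf) w0 w0' muE nuE.
have := W1_ge_sub lf w0 w0' muE nuE.
rewrite !onem// opprB [1 - _ + _]addrC addrA subrK.
set a := \sum_i _; set b := \sum_i _.
by case: (ger0P (a - b)); rewrite ?opprB.
Qed.

End wasserstein.

Lemma discrete_sumE d (T : measurableType d) (R : realType) (I : finType)
    (w : I -> R) (z : I -> T) B :
  discrete_sum w z B = (\sum_i w i * (z i \in B)%:R)%:E.
Proof. by rewrite /discrete_sum -sumEFin; apply: eq_bigr => i _; rewrite diracE. Qed.

Section matching.
Context {R : realType} {I : finType}.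
Variables (w w' : I -> R).
Hypotheses (w0 : forall i, 0 <= w i) (w0' : forall i, 0 <= w' i).
Hypotheses (w1 : \sum_i w i = 1) (w1' : \sum_i w' i = 1).

Let mn i := Num.min (w i) (w' i).
Let a i := w i - mn i.
Let b i := w' i - mn i.
Let T := \sum_i a i.

(* Keep the common mass of [w] and [w'] at each index, and spread the excess of
   [w] proportionally over the deficits. If there is no excess, then [T = 0] and
   the division by [T] gives [0], as needed. *)
Definition match_weight (s : I + I * I) : R :=
  match s with inl i => mn i | inr ij => a ij.1 * b ij.2 / T end.

Let a_ge0 i : 0 <= a i. Proof. by rewrite subr_ge0 ge_min lexx. Qed.
Let b_ge0 i : 0 <= b i. Proof. by rewrite subr_ge0 ge_min lexx orbT. Qed.
Let T_ge0 : 0 <= T. Proof. exact: sumr_ge0. Qed.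
Let bT : \sum_i b i = T. Proof. by rewrite /T !sumrB w1 w1'. Qed.

Let aT i : a i * T / T = a i.
Proof.
have [T0|T0] := eqVneq T 0; last by rewrite mulfK.
have /eqP := T0; rewrite psumr_eq0// => /allP/(_ i (mem_index_enum _))/eqP->.
by rewrite !mul0r.
Qed.

Let bTT i : b i * T / T = b i.
Proof.
have [T0|T0] := eqVneq T 0; last by rewrite mulfK.
have /eqP := T0; rewrite -bT psumr_eq0// => /allP/(_ i (mem_index_enum _))/eqP->.
by rewrite !mul0r.
Qed.

Lemma match_weight_ge0 s : 0 <= match_weight s.
Proof.
case: s => [i|[i j]] /=; first by rewrite le_min w0 w0'.
by rewrite divr_ge0// mulr_ge0.
Qed.

(** For [c] an indicator, this is the first marginal condition. *)
Lemma match_weight_fst (c : I -> R) :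
  \sum_s match_weight s * (match s with inl i => c i | inr ij => c ij.1 end) =
  \sum_i w i * c i.
Proof.
rewrite big_sumType /= -(pair_bigA _ (fun i j => a i * b j / T * c i)) /= -big_split /=.
apply: eq_bigr => i _; rewrite -mulr_suml -mulr_suml -mulr_sumr bT aT -mulrDl.
by rewrite /a addrC subrK.
Qed.

Lemma match_weight_snd (c : I -> R) :
  \sum_s match_weight s * (match s with inl i => c i | inr ij => c ij.2 end) =
  \sum_i w' i * c i.
Proof.
rewrite big_sumType /= -(pair_bigA _ (fun i j => a i * b j / T * c j)) /=.
rewrite exchange_big -big_split /=; apply: eq_bigr => i _.
by rewrite -mulr_suml -mulr_suml -mulr_suml [T * b i]mulrC bTT -mulrDl addrC subrK.
Qed.

Lemma match_weight_sum : \sum_s match_weight s = 1.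
Proof.
rewrite -[RHS]w1 -[RHS](eq_bigr _ (fun i _ => mulr1 (w i))) -match_weight_fst.
by apply: eq_bigr => -[i|ij] _; rewrite mulr1.
Qed.

(** Common mass stays at its index, with weight at most [1]; the excess has total mass at most the
    sum of the [|w i - w' i|] and costs at most [D] per unit. *)
Lemma match_weight_cost (c : I -> I -> R) (D : R) : (forall i j, 0 <= c i j <= D) ->
  \sum_s match_weight s * (match s with inl i => c i i | inr ij => c ij.1 ij.2 end) <=
  \sum_i c i i + D * \sum_i `|w i - w' i|.
Proof.
move=> cD; rewrite big_sumType /=; apply: lerD.
  apply: ler_sum => i _; have /andP[c0 _] := cD i i.
  apply: ler_piMl => //; rewrite ge_min; apply/orP; left.
  by rewrite -w1 (bigD1 i)//= lerDl sumr_ge0.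
apply: (@le_trans _ _ (\sum_(ij : I * I) a ij.1 * b ij.2 / T * D)).
  apply: ler_sum => -[i j] _ /=; have /andP[_] := cD i j; apply: ler_wpM2l.
  by rewrite divr_ge0// mulr_ge0.
rewrite -mulr_suml mulrC -(pair_bigA _ (fun i j => a i * b j / T)) /=.
under eq_bigr do rewrite -mulr_suml -mulr_sumr bT aT.
have [i0|I0] := pickP (@predT I); last by rewrite !big_pred0.
have D0 : 0 <= D by have /andP[/le_trans] := cD i0 i0; apply.
rewrite ler_wpM2l// ler_sum// => i _; rewrite /a /mn.
by case: (leP (w i) (w' i)); rewrite ?subrr// ler_norm.
Qed.

End matching.

Section wasserstein_upper.
Context {R : realType} {X : pmetricType R}.

(** The matching, placed on pairs of atoms, is a coupling whose cost bounds the infimum. *)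
Lemma W1_le (I : finType) (w w' : I -> R) (x x' : I -> X) (D : R)
    (mu nu : probability (borel X) R) :
  (forall i, 0 <= w i) -> (forall i, 0 <= w' i) ->
  \sum_i w i = 1 -> \sum_i w' i = 1 -> (forall y z : X, mdist y z <= D) ->
  (forall B, mu B = discrete_sum w (x : I -> borel X) B) ->
  (forall B, nu B = discrete_sum w' (x' : I -> borel X) B) ->
  (W1 mu nu <= (\sum_i mdist (x i) (x' i) + D * \sum_i `|w i - w' i|)%:E)%E.
Proof.
move=> w0 w0' w1 w1' bD muE nuE.
pose z (s : I + I * I) : borel X * borel X :=
  match s with inl i => (x i, x' i) | inr ij => (x ij.1, x' ij.2) end.
have m0 := match_weight_ge0 w0 w0'.
have [pi piE] := exists_discrete_probability z m0 (match_weight_sum w1 w1').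
apply: (@le_trans _ _ (\int[pi]_z (mdist (z.1 : X) (z.2 : X))%:E)%E).
  apply: ereal_inf_lbound; exists pi => // B mB; rewrite !piE muE nuE !discrete_sumE.
  rewrite -(match_weight_fst w1 w1' (fun i => ((x i : borel X) \in B)%:R)).
  rewrite -(match_weight_snd w1 w1' (fun i => ((x' i : borel X) \in B)%:R)).
  by split; congr EFin; apply: eq_bigr => -[i|ij] _; rewrite in_setX ?in_setT ?andbT.
have zm0 (y : borel X * borel X) : 0 <= mdist (y.1 : X) (y.2 : X) by exact: mdist_ge0.
apply: (le_trans (discrete_integral_le m0 (fun B _ => piE B) zm0)).
rewrite lee_fin.
have cost := @match_weight_cost _ _ _ _ w0 w1 w1' (fun i j => mdist (x i) (x' j)) D.
apply: le_trans (cost _) => [|i j]; last by rewrite mdist_ge0 bD.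
by apply: ler_sum => -[i|ij] _.
Qed.

End wasserstein_upper.

(** * The anti-Vietoris-Rips thickening *)

Section configurations.
Context {R : realType} {X : pmetricType R}.
Variables (r : R) (r_gt0 : 0 < r) (p : nat).
Hypothesis pack_p : forall S : set X, packing r S -> S #<= `I_p.

(* Points of weight [0] are allowed and unconstrained, so that one compact
   parameter space covers the measures with at most [p] atoms. *)
Definition config (x : 'I_p -> X) (w : 'I_p -> R) : Prop :=
  [/\ forall i, 0 <= w i, \sum_i w i = 1 &
      forall i j, i != j -> 0 < w i -> 0 < w j -> r <= mdist (x i) (x j)].

(** The atoms form an [r]-packing, so there are at most [p]; spare indices get weight [0] and a
    default point from [inord]. *)
Lemma avr_config (mu : AVRm X r) : exists x w, config x w /\
  forall B, avr_measure mu B = discrete_sum w (x : 'I_p -> borel X) B.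
Proof.
have [k [x [w [w0 w1 xr muE]]]] := avr_measureP mu.
have kp : (k < p)%N.
  have : (x \o inord) @` `I_k.+1 #<= `I_p.
    apply: pack_p => _ _ [a ak <-] [b bk <-] ab.
    by apply: (proj2 (xr _ _ _)); apply/eqP => eab; apply: ab; rewrite /= eab.
  rewrite (card_le_eql (inj_card_eq _)) ?card_le_II// => a b.
  rewrite !inE /= => ak bk xab; apply: contrapT => /eqP ab.
  have /xr[] : inord a != inord b :> 'I_k.+1; last by [].
  by apply: contra ab => /eqP/(congr1 val); rewrite /= !inordK// => ->.
have sumE (c : 'I_k.+1 -> R) :
    \sum_(i < p) (if (i < k.+1)%N then c (inord i) else 0) = \sum_i c i.
  rewrite -big_mkcond -(big_ord_widen _ (fun i => c (inord i)) kp).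
  by apply: eq_bigr => i _; rewrite inord_val.
exists (fun i => x (inord i)), (fun i => if (i < k.+1)%N then w (inord i) else 0).
split; first split.
- by move=> i; case: ifP => // _; exact: ltW.
- by rewrite sumE.
- move=> i j ij; case: ifP => [ik _|]; last by rewrite ltxx.
  case: ifP => [jk _|]; last by rewrite ltxx.
  apply: (proj2 (xr _ _ _)); apply: contra ij => /eqP/(congr1 val).
  by rewrite /= !inordK// => ij; apply/eqP/val_inj.
move=> B; rewrite muE -/(discrete_sum w (x : 'I_k.+1 -> borel X) B) !discrete_sumE.
rewrite -sumE; congr EFin; apply: eq_bigr => i _; case: ifP => // _.
by rewrite mul0r.
Qed.

(** Dropping the indices of weight [0] leaves points at mutual distance at least [r], distinct
    because [r > 0]. *)
Lemma config_avr x w : config x w -> exists mu : AVRm X r,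
  forall B, avr_measure mu B = discrete_sum w (x : 'I_p -> borel X) B.
Proof.
move=> [w0 w1 xr]; have [P PE] := exists_discrete_probability (x : 'I_p -> borel X) w0 w1.
pose A := [pred i | 0 < w i].
have sumA (c : 'I_p -> R) : \sum_i w i * c i = \sum_(i < #|A|) w (enum_val i) * c (enum_val i).
  rewrite -(big_enum_val (A := A) (fun i => w i * c i)) [RHS]big_mkcond /=.
  apply: eq_bigr => i _; rewrite inE; case: ifPn => //.
  by rewrite -leNgt => wi; rewrite (_ : w i = 0) ?mul0r//; apply/eqP; rewrite eq_le wi w0.
have [k kA] : exists k, k.+1 = #|A|.
  exists #|A|.-1; rewrite prednK//; apply/card_gt0P; apply: contrapT => /forallNP nA.
  have := w1; rewrite big1 => [/eqP|i _]; first by rewrite eq_sym oner_eq0.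
  by apply/eqP; rewrite eq_le w0 andbT leNgt; apply/negP; exact: nA.
pose e (i : 'I_k.+1) : 'I_p := enum_val (cast_ord kA i).
have sume (c : 'I_p -> R) : \sum_i w i * c i = \sum_i w (e i) * c (e i).
  rewrite sumA (reindex (cast_ord kA))//; apply: onW_bij.
  by exists (cast_ord (esym kA)); [exact: cast_ordK|exact: cast_ordKV].
have wpos i : 0 < w (e i) by exact: (enum_valP (cast_ord kA i)).
have sP : avr_supported r P.
  exists k, (x \o e), (w \o e); split=> //.
  - by rewrite -w1 -[RHS](eq_bigr _ (fun i _ => mulr1 (w i))) sume;
      apply: eq_bigr => i _; rewrite mulr1.
  - move=> i j ij; have rij : r <= mdist (x (e i)) (x (e j)).
      apply: xr => //; apply: contra ij => /eqP/enum_val_inj/cast_ord_inj ->.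
      exact: eqxx.
    by split=> //= xij; move: rij; rewrite xij mdistxx leNgt r_gt0.
  - move=> B; rewrite PE -/(discrete_sum (w \o e) (x \o e : 'I_k.+1 -> borel X) B).
    by rewrite !discrete_sumE sume.
by exists (AVRMeasure sP).
Qed.

End configurations.

(** * The dual distance and its box dimension *)

Section kantorovich.
Context {R : realType} {X : pmetricType R}.
Variables (r : R) (p : nat).
Variables (pt : AVRm X r -> 'I_p -> X) (wt : AVRm X r -> 'I_p -> R).
Hypothesis pw_config : forall mu, config r (pt mu) (wt mu).
Hypothesis pwE : forall mu B,
  avr_measure mu B = discrete_sum (wt mu) (pt mu : 'I_p -> borel X) B.

Let wt_ge0 mu i : 0 <= wt mu i. Proof. by have [] := pw_config mu. Qed.
Let wt_sum mu : \sum_i wt mu i = 1. Proof. by have [] := pw_config mu. Qed.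

Let expect (f : X -> R) mu := \sum_i wt mu i * f (pt mu i).

Let expect01 f mu : lip1 f -> 0 <= expect f mu <= 1.
Proof.
move=> [_ f01]; apply/andP; split.
  by apply: sumr_ge0 => i _; rewrite mulr_ge0//; have /andP[] := f01 (pt mu i).
rewrite -(wt_sum mu); apply: ler_sum => i _; rewrite ler_piMr//.
by have /andP[] := f01 (pt mu i).
Qed.

Let diffs mu nu := [set `|expect f mu - expect f nu| | f in @lip1 R X].

(* The bounded-Lipschitz dual distance: unlike [W1], its triangle inequality
   needs no gluing of couplings. *)
Definition dual_dist mu nu : R := sup (diffs mu nu).

Let diffs0 mu nu : diffs mu nu 0.
Proof.
exists (fun=> 0); last by rewrite /expect !big1 ?subrr ?normr0// => i _; rewrite mulr0.
by split=> [x y|x]; rewrite ?subrr ?mdist_ge0 ?lexx ?ler01.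
Qed.

Let has_sup_diffs mu nu : has_sup (diffs mu nu).
Proof.
split; first by exists 0.
exists 1 => _ [f /[dup] /(expect01 mu) + /(expect01 nu) + <-].
by rewrite ler_norml; lra.
Qed.

Lemma dual_dist_ge f mu nu : lip1 f ->
  `|\sum_i wt mu i * f (pt mu i) - \sum_i wt nu i * f (pt nu i)| <= dual_dist mu nu.
Proof. by move=> lf; apply: sup_upper_bound => //; exists f. Qed.

Lemma dual_dist_le mu nu c :
  (forall f, lip1 f -> `|expect f mu - expect f nu| <= c) -> dual_dist mu nu <= c.
Proof. by move=> h; apply: ge_sup => [|_ [f /h + <-]]; first by exists 0. Qed.

Lemma dual_dist_ge0 mu nu : 0 <= dual_dist mu nu.
Proof. exact: sup_upper_bound. Qed.

Lemma dual_distxx mu : dual_dist mu mu = 0.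
Proof.
apply/eqP; rewrite eq_le dual_dist_ge0 andbT; apply: dual_dist_le => f _.
by rewrite subrr normr0.
Qed.

Lemma dual_dist_sym mu nu : dual_dist mu nu = dual_dist nu mu.
Proof.
by apply/eqP; rewrite eq_le; apply/andP; split; apply: dual_dist_le => f lf;
  rewrite distrC; exact: dual_dist_ge.
Qed.

Lemma dual_dist_triangle mu nu xi : dual_dist mu xi <= dual_dist mu nu + dual_dist nu xi.
Proof.
apply: dual_dist_le => f lf; rewrite -(subrK (expect f nu) (expect f mu)) -addrA.
by rewrite (le_trans (ler_normD _ _))// lerD// dual_dist_ge.
Qed.

Lemma dual_dist_le_W1 mu nu :
  ((dual_dist mu nu)%:E <= W1 (avr_measure mu) (avr_measure nu))%E.
Proof.
have W1ge f : lip1 f -> ((`|expect f mu - expect f nu|)%:E <=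
    W1 (avr_measure mu) (avr_measure nu))%E.
  by move=> lf; apply: W1_ge lf _ _ _ _ (pwE mu) (pwE nu).
case: (W1 _ _) W1ge => [c||] h; last 2 first.
- exact: leey.
- have [f lf fE] := diffs0 mu nu; have := h _ lf.
  by rewrite fE leNgt ltNyr.
by rewrite lee_fin; apply: dual_dist_le => f /h; rewrite lee_fin.
Qed.

(** The function is 1-Lipschitz for the dual distance, hence for [W1], which defines the open
    sets. *)
Lemma continuous_dual_dist mu : continuous (dual_dist mu).
Proof.
apply/continuousP => A oA; suff : avr_open (dual_dist mu @^-1` A) by [].
move=> nu /= Anu; have /nbhs_ballP[e /= e0 eA] : nbhs (dual_dist mu nu) A.
  exact: open_nbhs_nbhs.
exists e => // xi; move=> /(le_lt_trans (dual_dist_le_W1 nu xi)); rewrite lte_fin => nuxi.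
apply: eA; rewrite /ball /= ltr_norml.
have := dual_dist_triangle mu nu xi; have := dual_dist_triangle mu xi nu.
rewrite (dual_dist_sym xi nu); lra.
Qed.

Lemma exists_separation (s : seq X) : exists t : R, [/\ 0 < t, t <= 1 &
  forall y z, y \in s -> z \in s -> y != z -> t <= mdist y z].
Proof.
pose t := \big[Num.min/1]_(yz <- [seq (y, z) | y <- s, z <- s] | yz.1 != yz.2) mdist yz.1 yz.2.
exists t; split.
- rewrite /t; elim/big_rec: _ => // -[y z] u /= yz u0.
  by rewrite lt_min u0 andbT mdist_gt0.
- by rewrite /t; elim/big_rec: _ => // i u _; rewrite ge_min orbC => ->.
move=> y z ys zs yz; apply: (@bigmin_inf_seq _ _ _ _ _ (y, z)) => //.
by apply/allpairsP; exists (y, z).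
Qed.

Lemma dual_dist_eq0 mu nu : dual_dist mu nu = 0 -> mu = nu.
Proof.
move=> d0; suff : avr_measure mu = avr_measure nu.
  case: mu nu {d0} => [P hP] [Q hQ] /= PQ; subst Q.
  by congr AVRMeasure; exact: Prop_irrelevance.
apply/eq_probability/funext => B; rewrite !pwE !discrete_sumE; congr EFin.
pose s := codom (pt mu) ++ codom (pt nu).
have [t [t0 t1 st]] := exists_separation s.
(* The distance to the atoms outside [B], cut off at the separation [t]: on atoms it is [t] times
   the indicator of [B], so equal expectations give equal measures of [B]. *)
pose f y := \big[Num.min/t]_(z <- s | (z : borel X) \notin B) mdist y z.
have lf : lip1 f.
  split=> [y z|y].
    rewrite /f; elim/big_rec2: _ => [|u a b _ ab]; first by rewrite subrr mdist_ge0.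
    have := metric_triangle y z u.
    by case: (leP (mdist y u) b) => ?; case: (leP (mdist z u) a) => ?; lra.
  apply/andP; split; rewrite /f; elim/big_rec: _ => //; first exact: ltW.
    by move=> z u _ u0; rewrite le_min mdist_ge0.
  by move=> z u _; rewrite ge_min orbC => ->.
have fE y : y \in s -> f y = t * ((y : borel X) \in B)%:R.
  move=> ys; have [yB|yB] := boolP ((y : borel X) \in B).
    rewrite mulr1 /f; apply/eqP; rewrite eq_le; apply/andP; split.
      by elim/big_rec: _ => // z u _; rewrite ge_min orbC => ->.
    rewrite big_seq_cond; elim/big_rec: _ => // z u /andP[zs zB] tu.
    rewrite le_min tu andbT; apply: st => //.
    by apply: contra zB => /eqP <-.
  rewrite mulr0; apply/eqP; rewrite eq_le; apply/andP; split; last first.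
    by have [_ /(_ y)/andP[]] := lf.
  by apply: (@bigmin_inf_seq _ _ _ _ _ y) => //; rewrite mdistxx.
have := dual_dist_ge mu nu lf; rewrite d0 normr_le0 subr_eq0 => /eqP.
have sE xi : {subset codom (pt xi) <= s} ->
    \sum_i wt xi i * f (pt xi i) = t * \sum_i wt xi i * ((pt xi i : borel X) \in B)%:R.
  move=> xis; rewrite mulr_sumr; apply: eq_bigr => i _.
  by rewrite fE ?xis ?codom_f// mulrCA.
rewrite !sE; [|by move=> y ys; rewrite mem_cat ys orbT|by move=> y ys; rewrite mem_cat ys].
by apply: mulfI; rewrite gt_eqF.
Qed.

(** Points move first, at the weights of [nu]; then the weights change, against values of [f] in
    [[0, 1]]. *)
Lemma dual_dist_lipschitz mu nu e :
  (forall i, mdist (pt mu i) (pt nu i) <= e) ->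
  dual_dist mu nu <= e + \sum_i `|wt mu i - wt nu i|.
Proof.
move=> he; apply: dual_dist_le => f lf.
have -> : expect f mu - expect f nu =
    \sum_i wt nu i * (f (pt mu i) - f (pt nu i)) +
    \sum_i (wt mu i - wt nu i) * f (pt mu i).
  by rewrite /expect -sumrB -big_split; apply: eq_bigr => i _ /=; ring.
apply: (le_trans (ler_normD _ _)); apply: lerD; apply: (le_trans (ler_norm_sum _ _ _)).
  apply: (@le_trans _ _ (\sum_i wt nu i * e)); last by rewrite -mulr_suml wt_sum mul1r.
  apply: ler_sum => i _; rewrite normrM ger0_norm//; apply: ler_wpM2l => //.
  exact: le_trans (lip1_norm _ _ lf) (he i).
apply: ler_sum => i _; rewrite normrM; apply: ler_piMr => //.
by rewrite ger0_norm; have [_ /(_ (pt mu i))/andP[]] := lf.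
Qed.

End kantorovich.

(** The last weight is determined by the others, so it differs by at most [q * e]. This saves one
    dimension. *)
Lemma sum_weight_le (R : realType) q (w w' : 'I_q.+1 -> R) e :
  \sum_i w i = 1 -> \sum_i w' i = 1 ->
  (forall i : 'I_q, `|w (widen_ord (leqnSn q) i) - w' (widen_ord (leqnSn q) i)| <= e) ->
  \sum_i `|w i - w' i| <= 2 * q%:R * e.
Proof.
move=> w1 w1' we; rewrite big_ord_recr /=.
have le_qe : \sum_(i < q) `|w (widen_ord (leqnSn q) i) - w' (widen_ord (leqnSn q) i)| <= q%:R * e.
  apply: (@le_trans _ _ (\sum_(i < q) e)); first exact: ler_sum.
  by rewrite sumr_const card_ord mulr_natl.
rewrite -mulrA mulr2n mulrDl mul1r; apply: lerD => //; apply: le_trans le_qe.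
move: w1 w1'; rewrite !big_ord_recr /= => w1 w1'.
rewrite (_ : w ord_max - w' ord_max =
  - \sum_(i < q) (w (widen_ord (leqnSn q) i) - w' (widen_ord (leqnSn q) i))).
  by rewrite normrN ler_norm_sum.
by rewrite sumrB; lra.
Qed.

(** The label records the pieces of the [q.+1] points and the cells of the first [q] weights,
    [n * q.+1 + q] parameters in all. *)
Lemma box_dim_dual_dist (R : realType) (X : pmetricType R) (r : R) (q n : nat)
    (pt : AVRm X r -> 'I_q.+1 -> X) (wt : AVRm X r -> 'I_q.+1 -> R) :
  (forall mu, config r (pt mu) (wt mu)) ->
  box_dim_le (fun x y : X => mdist x y) n ->
  box_dim_le (dual_dist pt wt) (n.+1 * q.+1).-1.
Proof.
move=> cfg [C [L hM]].
have w0 mu i : 0 <= wt mu i by have [] := cfg mu.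
have w1 mu : \sum_i wt mu i = 1 by have [] := cfg mu.
have wle mu i : `|wt mu i| <= 1.
  by rewrite ger0_norm// -(w1 mu) (bigD1 i)//= lerDl sumr_ge0.
exists (C ^ q.+1 * 3 ^ q)%N, (L + 2 * q%:R) => m m0; have [T [l [cardT hl]]] := hM m m0.
exists ({ffun 'I_q.+1 -> T} * {ffun 'I_q -> 'I_(2 * m).+1})%type.
exists (fun mu => ([ffun i => l (pt mu i)],
  [ffun i => cell m (wt mu (widen_ord (leqnSn q) i))])); split.
  have -> : ((n.+1 * q.+1).-1 = n * q.+1 + q)%N by nia.
  rewrite card_prod !card_ffun !card_ord expnD.
  rewrite mulnACA expnM -!expnMn; apply: leq_mul; first by rewrite leq_exp2r.
  by case: q {pt wt cfg w0 w1 wle} => // q'; rewrite leq_exp2r//; lia.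
move=> mu nu [/ffunP lE /ffunP cE].
have := @dual_dist_lipschitz _ _ _ _ pt wt cfg mu nu (L / m%:R).
move=> /(_ _)/le_trans; apply => [i|].
  by apply: hl; have := lE i; rewrite !ffunE.
rewrite mulrDl lerD2l -[_ / m%:R]mulrA -[m%:R^-1]mul1r mulrA.
apply: sum_weight_le => // i; apply: cell_eq => //.
by have := cE i; rewrite !ffunE.
Qed.

(** * Compactness of the thickening *)

Section compactness.
Context {R : realType}.

Lemma ultra_map_cvg (T : Type) (Y : topologicalType) (F : set_system T) (f : T -> Y)
    (K : set Y) : UltraFilter F -> compact K -> (forall t, K (f t)) ->
  exists2 y, K y & f @ F --> y.
Proof.
move=> FU cK fK; have [|y [Ky cly]] := cK (f @ F) _.
  by apply: (@filterS _ F _ setT) => [t _|]; [exact: fK|exact: filterT].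
exists y => // B yB; have [//|FB] := in_ultra_setVsetC (f @^-1` B) FU.
by have [z []] := cly (~` B) B FB yB.
Qed.

Lemma compact_mdist_bounded (X : pmetricType R) : compact [set: X] ->
  exists D : R, forall y z : X, mdist y z <= D.
Proof.
move=> cX; have [x|x|s hs] := @compact_finite_subcover X (fun x => (ball x 1)^°) cX.
- exact: open_interior.
- exact: nbhsx_ballx.
pose D := \sum_(x <- s) mdist point x + 1.
have hD (y : X) : mdist point y <= D.
  have [x xs /interior_subset] := hs y; rewrite ballEmdist /= => xy.
  apply: (le_trans (metric_triangle point x y)); apply: lerD; last exact: ltW.
  rewrite (big_rem x)//= lerDl; apply: sumr_ge0 => z _; exact: mdist_ge0.
exists (D + D) => y z; apply: (le_trans (metric_triangle y point z)).
by apply: lerD => //; rewrite metric_sym.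
Qed.

(** Along an ultrafilter, points and weights converge; the limit is a configuration, and the bound
    of [W1_le] on the distance to it tends to [0]. *)
Lemma compact_AVRm (X : pmetricType R) (r : R) (p : nat) : 0 < r ->
  (forall S : set X, packing r S -> S #<= `I_p) ->
  compact [set: X] -> compact [set: AVRm X r].
Proof.
move=> r0 pack_p cX; rewrite compact_ultra => F FU _.
have /choice[pt] := avr_config pack_p => /choice[wt cfg].
have [D hD] := compact_mdist_bounded cX.
have w0 mu i : 0 <= wt mu i by have [[]] := cfg mu.
have w1 mu : \sum_i wt mu i = 1 by have [[]] := cfg mu.
have wle mu i : wt mu i <= 1.
  by rewrite -(w1 mu) (bigD1 i)//= lerDl sumr_ge0.
have /choice[x xP] i : exists x, (fun mu => pt mu i) @ F --> (x : X).
  by have [y _] := ultra_map_cvg FU cX (fun mu => Logic.I : [set: X] (pt mu i)); exists y.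
have /choice[w wP] i : exists w, 0 <= w /\ (fun mu => wt mu i) @ F --> (w : R).
  have [|y] := ultra_map_cvg (f := fun mu => wt mu i) FU (@segment_compact R 0 1).
    by move=> mu /=; rewrite in_itv /= w0 wle.
  by rewrite /= in_itv /= => /andP[y0 _]; exists y.
have near_x i (e : R) : 0 < e -> \forall mu \near F, mdist (x i) (pt mu i) < e.
  move=> e0; have := xP i (ball (x i) e) (nbhsx_ballx _ _ e0).
  by rewrite ballEmdist.
have cw : config r x w.
  split=> [i||i j ij wi wj]; first by have [] := wP i.
    have wsum : (fun mu => \sum_i wt mu i) @ F --> \sum_i w i.
      by apply: (cvg_big (@add_continuous R)) => i _; have [] := wP i.
    have w1cst : (fun mu => \sum_i wt mu i) @ F --> (1 : R).
      by rewrite (_ : (fun mu => _) = cst 1); [exact: cvg_cst|exact/funext].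
    exact: (cvg_unique _ wsum w1cst).
  apply/ler_addgt0Pr => e e0; have e20 : 0 < e / 2 by rewrite divr_gt0.
  (* Positive limit weights make the weights eventually positive, so the separation holds eventually
     and passes to the limit. *)
  have ni : \forall mu \near F, 0 < wt mu i by apply: cvgr_gt wi; have [] := wP i.
  have nj : \forall mu \near F, 0 < wt mu j by apply: cvgr_gt wj; have [] := wP j.
  have [mu [[[mi mj] di] dj]] := filter_ex (filterI (filterI (filterI ni nj)
    (near_x i _ e20)) (near_x j _ e20)).
  have [[_ _ /(_ i j ij mi mj) rij] _] := cfg mu.
  rewrite (le_trans rij)// [e]splitr.
  have := metric_triangle (pt mu i) (x i) (pt mu j).
  have := metric_triangle (x i) (x j) (pt mu j).
  rewrite (metric_sym (pt mu i) (x i)); lra.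
have [mu muE] := config_avr r0 cw; exists mu; split => // U.
rewrite nbhsE => -[V [oV Vmu] VU]; apply: (filterS VU).
have [e e0 eV] : exists2 e : R, 0 < e &
    forall nu, (W1 (avr_measure mu) (avr_measure nu) < e%:E)%E -> V nu by exact: oV.
have cost0 : (fun nu => \sum_i mdist (x i) (pt nu i) + D * \sum_i `|w i - wt nu i|) @ F -->
    (0 : R).
  rewrite (_ : nbhs (0 : R) = nbhs (\sum_(i < p) 0 + D * \sum_(i < p) (0 : R))); last first.
    by rewrite !big1// mulr0 addr0.
  apply: cvgD; first apply: (cvg_big (@add_continuous R)) => i _.
    apply/cvgrPdist_lt => d d0; near do rewrite sub0r normrN ger0_norm ?mdist_ge0//.
    exact: near_x.
  apply: cvgMl_tmp; apply: (cvg_big (@add_continuous R)) => i _.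
  have [_ wi] := wP i.
  rewrite (_ : nbhs (0 : R) = nbhs `|w i - w i|); last by rewrite subrr normr0.
  by apply: cvg_norm; apply: cvgB => //; exact: cvg_cst.
have : \forall nu \near F, \sum_i mdist (x i) (pt nu i) + D * \sum_i `|w i - wt nu i| < e.
  by apply: cvgr_lt e0.
apply: filterS => nu lt_e; apply: eV.
have [[_ _ _] nuE] := cfg nu; have [w0' w1' _] := cw.
by apply: (le_lt_trans (W1_le w0' (w0 nu) w1' (w1 nu) hD muE nuE)); rewrite lte_fin.
Unshelve. all: by end_near. Qed.

End compactness.

Unset Implicit Arguments.

Theorem corollary6p2 (R : realType) (n : nat) (M : pmetricType R)
    (A : smooth_atlas R n M) (g : riemannian_metric A)
    (M_geodesic : forall x y : M, (mdist x y)%:E = geodesic_dist g x y)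
    (M_compact : compact [set: M]) (M_connected : connected [set: M])
    (r : R) (r_gt0 : 0 < r) (p : nat) (p_pack : is_packing_number M r p)
    (k : nat) (k_ge : (n.+1 * p <= k)%N) :
  cech_cohomology_vanishes (AVRm M r) k.
Proof.
have [_ pack_p] := p_pack.
have p0 : (0 < p)%N.
  have : [set (point : M)] #<= `I_p by apply: pack_p => x y -> ->.
  by case: (p) => //; rewrite II0 card_le0 => /eqP/seteqP[/(_ point erefl)].
case: p p0 k_ge pack_p {p_pack} => // q _ k_ge pack_p.
have /choice[pt] := avr_config pack_p => /choice[wt cfg].
have pw mu : config r (pt mu) (wt mu) by have [] := cfg mu.
have pwE mu B : avr_measure mu B = discrete_sum (wt mu) (pt mu : 'I_q.+1 -> borel M) B.
  by have [_] := cfg mu.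
(* A Dirac measure, the default element for the list of centres. *)
have [mu0 _] : exists mu : AVRm M r, forall B, avr_measure mu B =
    discrete_sum (fun i : 'I_q.+1 => (i == ord0)%:R) (fun=> point : borel M) B.
  apply: config_avr => //; split=> [i||i j ij]; first exact: ler0n.
    by rewrite (bigD1 ord0)//= big1 ?addr0// => i /negPf ->.
  rewrite !ltr0n !lt0b => /eqP i0 /eqP j0.
  by move: ij; rewrite i0 j0 eqxx.
have cX := compact_AVRm r_gt0 pack_p M_compact.
have box := box_dim_dual_dist pw (box_dim_manifold M_geodesic M_compact).
apply: (@cech_vanishes_of_order _ (n.+1 * q.+1)) => [U oU|]; last by rewrite k_ge muln_gt0.
have := cover_order_box_dim mu0 cX (continuous_dual_dist pw pwE) (dual_dist_ge0 pw)
  (dual_dist_eq0 pw pwE) (dual_distxx pw) (dual_dist_triangle pw) box oU.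
by rewrite prednK// muln_gt0.
Qed.
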